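(* Suppose $\Omega\subseteq\mathcal A^d$ is a balanced NC domain that has an exhaustion $(E_k)_{k\ge1}$, and $F:\Omega\to B(\mathcal H)$ is NC and bounded on each $E_k$. Suppose that for some $k$ there is a sequence $(x_j)$ in $E_k$ that converges to $x\in E_k$ in the strong operator topology. Then $F(x_j)$ converges to $F(x)$ in the strong operator topology.
   Context: Throughout, $\mathcal H$ is an infinite-dimensional complex Hilbert space, $\mathcal H^{(n)}=\oplus_{j=1}^n\mathcal H$, $\mathcal H^{(\infty)}=\oplus_{j=1}^\infty\mathcal H$, and $\mathcal A\subseteq B(\mathcal H)$ is a unital norm-closed subalgebra with the direct sum property: for every $n\ge1$ there is a unitary $U_n:\mathcal H^{(n)}\to\mathcal H$ with $U_n\,\mathcal T_n(\mathcal A)\,U_n^*\subseteq\mathcal A$, where $\mathcal T_n(\mathcal A)$ is the set of upper triangular $n\times n$ matrices with entries in $\mathcal A$. Fix a positive integer $d$; $d$-tuples are written $x=(x^1,\dots,x^d)$, $\mathcal A^d$ carries the relative norm topology, and products, direct sums, conjugations, strong operator convergence etc. of $d$-tuples are taken coordinatewise. NC domain: a set $\Omega\subseteq\mathcal A^d$ that is open, bounded, and closed under finite direct sums: for each $n\ge2$, with the unitary $U_n:\mathcal H^{(n)}\to\mathcal H$ (the same one as in the direct sum property of $\mathcal A$), $U_n(x_1\oplus\cdots\oplus x_n)U_n^*\in\Omega$ whenever $x_1,\dots,x_n\in\Omega$. NC function: $F:\Omega\to B(\mathcal H)$ that is locally bounded on $\Omega$ and intertwining preserving, i.e. whenever $x,y\in\Omega$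 and $L\in B(\mathcal H)$ satisfy $Lx^r=y^rL$ for $1\le r\le d$, then $LF(x)=F(y)L$. $\Omega$ is balanced if $\alpha\Omega\subseteq\Omega$ for every $\alpha\in\mathbb C$ with $|\alpha|\le1$. A family $\{E_k\}_{k=1}^\infty$ is an exhaustion of $\Omega$ if (1) $E_k\subseteq\operatorname{int}(E_{k+1})$ for all $k$; (2) $\Omega=\bigcup_{k=1}^\infty E_k$; (3) each $E_k$ is bounded; (4) each $E_k$ is closed under countable direct sums: if $(x_j)$ is a sequence in $E_k$, there exists a unitary $U:\mathcal H\to\mathcal H^{(\infty)}$ such that $U^{-1}(x_1\oplus x_2\oplus\cdots)U\in E_k$. *)

(* Defs.v *)
From HB Require Import structures.
From mathcomp Require Import all_boot all_order all_algebra.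
From mathcomp Require Import sesquilinear.
From mathcomp Require Import complex.
From mathcomp Require Import all_classical all_reals all_analysis.
Set Implicit Arguments.
Unset Strict Implicit.
Unset Printing Implicit Defensive.
Import Order.TTheory GRing.Theory Num.Theory.
Import numFieldNormedType.Exports.
Local Open Scope classical_set_scope.
Local Open Scope ring_scope.

HB.mixin Record isHilbert (R : realType) H
    of CompleteNormedModule R[i] H := {
  inner : {dot H for (@Num.conj R[i])} ;
  inner_normE : forall h : H, `|h| ^+ 2 = inner h h
}.

#[short(type="hilbertType")]
HB.structure Definition Hilbert (R : realType) :=
  { H of isHilbert R H & CompleteNormedModule R[i] H }.

Section HilbertSpace.
Context {R : realType} {H : hilbertType R}.
Implicit Types (h : H) (T : H -> H).

Definition infinite_dimensional (V : lmodType R[i]) : Prop :=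
  ~ exists (n : nat) (e : 'I_n -> V),
      forall v, exists c : 'I_n -> R[i], v = \sum_(i < n) c i *: e i.

(* The norm of [H] takes its values in [R[i]]; these values are real. *)
Definition hnorm h : R := complex.Re `|h|.

(* B(H) *)
Definition bounded_op : set (H -> H) :=
  [set T : H -> H | linear T /\ exists M : R, forall h, hnorm (T h) <= M * hnorm h].

Definition opnorm T : R := sup [set hnorm (T h) | h in [set h | hnorm h <= 1]].

(* [Us] is the adjoint of [U], and both U^* U and U U^* are the identity.
   The spaces are the subspaces [D] of [V] and [E] of [W], with the inner
   products [dD] and [dE]. *)
Record unitary (V W : lmodType R[i])
    (D : set V) (dD : V -> V -> R[i]) (E : set W) (dE : W -> W -> R[i])
    (U : V -> W) (Us : W -> V) : Prop := Unitary {
  unitary_fun : set_fun D E U ;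
  unitary_adj_fun : set_fun E D Us ;
  unitary_linear : forall (a : R[i]) u v, D u -> D v ->
    U (a *: u + v) = a *: U u + U v ;
  unitary_adjoint : forall v w, D v -> E w -> dE (U v) w = dD v (Us w) ;
  unitary_adjK : forall v, D v -> Us (U v) = v ;
  unitaryK : forall w, E w -> U (Us w) = w
}.

(* H^(n) is the type ['I_n -> H] with this inner product. *)
Definition inner_fin (n : nat) (u v : 'I_n -> H) : R[i] :=
  \sum_(i < n) inner (u i) (v i).

(* H^(oo) is the set of square-summable sequences, with the inner product
   [inner_oo], a series that converges on [ell2]. *)
Definition ell2 : set (nat -> H) :=
  [set u | cvgn (series (fun j => hnorm (u j) ^+ 2))].

Definition inner_oo (u v : nat -> H) : R[i] :=
  limn (series (fun j => inner (u j) (v j) : R[i]^o)).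

Definition unitary_from_fin (n : nat) : (('I_n -> H) -> H) ->
    (H -> ('I_n -> H)) -> Prop :=
  unitary setT (@inner_fin n) setT (fun h k : H => inner h k).

Definition unitary_to_oo : (H -> (nat -> H)) -> ((nat -> H) -> H) -> Prop :=
  unitary setT (fun h k : H => inner h k) ell2 inner_oo.

Definition dsum (I : Type) (x : I -> (H -> H)) : (I -> H) -> (I -> H) :=
  fun v i => x i (v i).

Definition opmx (n : nat) (M : 'M[H -> H]_n) : ('I_n -> H) -> ('I_n -> H) :=
  fun v i => \sum_(j < n) M i j (v j).

Definition upper_tri (A : set (H -> H)) (n : nat) : set 'M[H -> H]_n :=
  [set M : 'M[H -> H]_n | forall i j : 'I_n,
     if (j < i)%N then M i j = 0 else A (M i j)].

Record unital_closed_subalgebra (A : set (H -> H)) : Prop := {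
  subalg_bounded : A `<=` bounded_op ;
  subalg_one : A idfun ;
  subalg_add : forall S T, A S -> A T -> A (S + T) ;
  subalg_scale : forall (a : R[i]) T, A T -> A (a *: T) ;
  subalg_comp : forall S T, A S -> A T -> A (S \o T) ;
  subalg_closed : forall T, bounded_op T ->
    (forall e : R, 0 < e -> exists2 S, A S & opnorm (T - S) < e) -> A T
}.

Definition direct_sum_property (A : set (H -> H))
    (U : forall n, ('I_n -> H) -> H) (Us : forall n, H -> ('I_n -> H)) : Prop :=
  forall n : nat, (1 <= n)%N ->
    unitary_from_fin (U n) (Us n) /\
    forall M : 'M[H -> H]_n, upper_tri A M -> A (U n \o opmx M \o Us n).

Section Tuples.
Context {d : nat}.
Local Notation tup := ('I_d -> (H -> H)).
Implicit Types (A : set (H -> H)) (O E : set tup) (x y : tup).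

Definition tpow A : set tup := [set x | forall r, A (x r)].

Definition tball x (e : R) : set tup :=
  [set y | forall r, opnorm (y r - x r) < e].

Definition tbounded E : Prop :=
  exists M : R, forall x, E x -> forall r, opnorm (x r) <= M.

(* Interior in A^d, for the relative norm topology. *)
Definition tinterior A E : set tup :=
  [set x | tpow A x /\ exists2 e : R, 0 < e & tpow A `&` tball x e `<=` E].

Record nc_domain A (U : forall n, ('I_n -> H) -> H)
    (Us : forall n, H -> ('I_n -> H)) O : Prop := {
  nc_domain_sub : O `<=` tpow A ;
  nc_domain_open : O `<=` tinterior A O ;
  nc_domain_bounded : tbounded O ;
  nc_domain_dsum : forall n : nat, (2 <= n)%N ->
    forall x : 'I_n -> tup, (forall i, O (x i)) ->
    O (fun r => U n \o dsum (fun i => x i r) \o Us n)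
}.

(* The values of [F] outside [O] are irrelevant. *)
Record nc_function O (F : tup -> (H -> H)) : Prop := {
  nc_function_bounded_op : forall x, O x -> bounded_op (F x) ;
  nc_function_locally_bounded : forall x, O x ->
    exists2 e : R, 0 < e &
      exists M : R, forall y, O y -> tball x e y -> opnorm (F y) <= M ;
  nc_function_intertwining : forall x y, O x -> O y ->
    forall L, bounded_op L -> (forall r, L \o x r = y r \o L) ->
    L \o F x = F y \o L
}.

Definition balanced O : Prop :=
  forall (a : R[i]) x, `|a| <= 1 -> O x -> O (a *: x).

Definition closed_countable_dsum E : Prop :=
  forall x : nat -> tup, (forall j, E (x j)) ->
  exists U : H -> (nat -> H), exists Ui : (nat -> H) -> H,
    unitary_to_oo U Ui /\ E (fun r => Ui \o dsum (fun j => x j r) \o U).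

Record exhaustion A O (E : nat -> set tup) : Prop := {
  exhaustion_int : forall k, E k `<=` tinterior A (E k.+1) ;
  exhaustion_cover : O = \bigcup_k E k ;
  exhaustion_bounded : forall k, tbounded (E k) ;
  exhaustion_dsum : forall k, closed_countable_dsum (E k)
}.

Definition bounded_on (F : tup -> (H -> H)) E : Prop :=
  exists M : R, forall x, E x -> opnorm (F x) <= M.

End Tuples.

Definition sot_cvg (T_ : nat -> (H -> H)) T : Prop :=
  forall h, (fun j => T_ j h) @ \oo --> T h.

Definition sot_cvg_tuple (d : nat) (x_ : nat -> 'I_d -> (H -> H))
    (x : 'I_d -> (H -> H)) : Prop :=
  forall r, sot_cvg (fun j => x_ j r) (x r).

End HilbertSpace.

(* Main.v *)
Require Import Defs.
From mathcomp Require Import all_boot all_order all_algebra.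
From mathcomp Require Import complex.
From mathcomp Require Import all_classical all_reals all_analysis.
From mathcomp Require Import sesquilinear ring lra.
Import Order.TTheory GRing.Theory Num.Theory.
Import numFieldNormedType.Exports.
Set Implicit Arguments.
Unset Strict Implicit.
Unset Printing Implicit Defensive.
Local Open Scope classical_set_scope.
Local Open Scope ring_scope.

(** The direct sum X of x, x_0, x_1, ... lies in E_k, and F(aX) is the direct
    sum of the F(a x_j) for |a| <= 1.  As Omega is open and balanced, F(aX) is
    defined and bounded for |a| <= rho with some rho > 1.  The functions
    g_j(a) = F(a x_j) h - F(a x) h therefore extend to |a| <= rho with a common
    bound.  By the three circles theorem g_j(1) -> 0 follows as soon as g_j -> 0
    uniformly on one small circle |a| = r.

    Both the regularity in a and the behaviour near 0 come from the intertwining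
    property alone.  The column ((c/z)^n, ..., c/z, 1) intertwines (a + z) x with
    B (x) x, where B is the upper bidiagonal matrix with diagonal
    (a, ..., a, a + z) and superdiagonal c; the first row of F(B (x) x) then
    gives the Taylor expansion of F at a x with a bounded remainder.  Third-order
    expansions suffice for the maximum principle, via the parallelogram law.
    For a = 0 the size of B (x) x does not depend on n, which makes the remainder
    geometrically small near 0, while the coefficients are noncommutative
    polynomials in x, because the nilpotent points B (x) x are intertwined with
    truncated creation operators; such polynomials are continuous on bounded sets
    for the strong operator topology. *)

Local Notation cn := Normc.normc.
Local Notation "x %:C" := (real_complex _ x) (format "x %:C") : ring_scope.

(** * Elementary consequences of linearity *)

Section LinearMaps.
Context {K : pzRingType} {V W : lmodType K} (f : V -> W) (hf : linear f).

Lemma lin0 : f 0 = 0.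
Proof. by have := hf (-1) 0 0; rewrite !scaleN1r oppr0 addr0 addNr. Qed.

Lemma linD u v : f (u + v) = f u + f v.
Proof. by have := hf 1 u v; rewrite !scale1r. Qed.

Lemma linZ a u : f (a *: u) = a *: f u.
Proof. by have := hf a u 0; rewrite !addr0 lin0 addr0. Qed.

Lemma linB u v : f (u - v) = f u - f v.
Proof. by rewrite -scaleN1r linD linZ scaleN1r. Qed.

Lemma lin_sum (I : Type) (r : seq I) (P : pred I) (v : I -> V) :
  f (\sum_(i <- r | P i) v i) = \sum_(i <- r | P i) f (v i).
Proof. exact: (big_morph f linD lin0). Qed.

End LinearMaps.

(** * Real-valued norms and bounded operators *)

Section HilbertNorm.
Context {R : realType} {H : hilbertType R}.
Implicit Types (h k : H) (a : R[i]) (T S : H -> H).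

Lemma normE h : `|h| = (hnorm h)%:C.
Proof.
have := normr_ge0 h; rewrite /hnorm; case: (`|h|) => u v /=.
by rewrite lecE /= => /andP[/eqP -> _].
Qed.

Lemma normcE a : `|a| = (cn a)%:C.
Proof. by []. Qed.

Lemma normc_ge0 a : 0 <= cn a.
Proof. by rewrite -lecR -normcE normr_ge0. Qed.

Lemma normcR (x : R) : cn (x%:C) = `|x|.
Proof. by rewrite /= expr0n /= addr0 sqrtr_sqr. Qed.

Lemma normcN a : cn (- a) = cn a.
Proof. by case: a => x y /=; rewrite !sqrrN. Qed.

Lemma normcX a n : cn (a ^+ n) = cn a ^+ n.
Proof.
by elim: n => [|n ih]; rewrite ?Normc.normc1 // !exprS Normc.normcM ih.
Qed.

Lemma normcD a b : cn (a + b) <= cn a + cn b.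
Proof. by have := ler_normD a b; rewrite !normcE -rmorphD lecR. Qed.

Lemma normc_gt0 a : (0 < cn a) = (a != 0).
Proof.
rewrite lt_def normc_ge0 andbT; congr (~~ _); apply/eqP/eqP => [|->].
  exact: Normc.eq0_normc.
exact: Normc.normc0.
Qed.

Lemma hnorm_ge0 h : 0 <= hnorm h.
Proof. by rewrite -lecR -normE normr_ge0. Qed.

Lemma hnormZ a h : hnorm (a *: h) = cn a * hnorm h.
Proof. by apply: complexI; rewrite -normE normrZ normE rmorphM. Qed.

Lemma hnorm_triangle h k : hnorm (h + k) <= hnorm h + hnorm k.
Proof. by have := ler_normD h k; rewrite !normE -rmorphD lecR. Qed.

Lemma hnorm0 : hnorm (0 : H) = 0.
Proof. by apply: complexI; rewrite -normE normr0. Qed.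

Lemma hnorm_opp h : hnorm (- h) = hnorm h.
Proof. by apply: complexI; rewrite -!normE normrN. Qed.

Lemma hnorm_triangleB h k : hnorm (h - k) <= hnorm h + hnorm k.
Proof. by rewrite -(hnorm_opp k) hnorm_triangle. Qed.

Lemma hnorm_sum (I : Type) (r : seq I) (P : pred I) (v : I -> H) :
  hnorm (\sum_(i <- r | P i) v i) <= \sum_(i <- r | P i) hnorm (v i).
Proof.
elim/big_ind2: _ => [|u x v' y hu hv|//]; first by rewrite hnorm0.
exact: le_trans (hnorm_triangle _ _) (lerD hu hv).
Qed.

Lemma inner_hnorm h : inner h h = (hnorm h ^+ 2)%:C.
Proof. by rewrite -inner_normE normE rmorphXn. Qed.

Lemma parallelogram h k :
  hnorm (h + k) ^+ 2 + hnorm (h - k) ^+ 2 =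
  hnorm h ^+ 2 *+ 2 + hnorm k ^+ 2 *+ 2.
Proof.
apply: complexI; rewrite !mulr2n !rmorphD /= -!inner_hnorm.
by rewrite !linearDl !linearDr !linearNl !linearNr /=; ring.
Qed.

Lemma bounded_opP T : bounded_op T ->
  exists2 M : R, 0 <= M & forall h, hnorm (T h) <= M * hnorm h.
Proof.
case=> _ [M hM]; exists `|M| => // h.
by apply: le_trans (hM h) _; rewrite ler_wpM2r ?hnorm_ge0 // ler_norm.
Qed.

Lemma bounded_lin T : bounded_op T -> linear T.
Proof. by case. Qed.

Lemma bounded_id : bounded_op (idfun : H -> H).
Proof. by split=> //; exists 1 => h; rewrite mul1r. Qed.

Lemma bounded_comp S T : bounded_op S -> bounded_op T -> bounded_op (S \o T).
Proof.
move=> hS hT; have [M M0 hM] := bounded_opP hS; have [N N0 hN] := bounded_opP hT.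
split=> [a u v|]; first by rewrite /= (bounded_lin hT) (bounded_lin hS).
exists (M * N) => h; apply: le_trans (hM _) _.
by rewrite -mulrA ler_wpM2l.
Qed.

Lemma bounded_scale a T : bounded_op T -> bounded_op (a *: T).
Proof.
move=> hT; have [N N0 hN] := bounded_opP hT; split=> [b u v|].
  by rewrite !scalrfctE (bounded_lin hT) scalerDr !scalerA mulrC.
exists (cn a * N) => h; rewrite scalrfctE hnormZ.
by rewrite -mulrA ler_wpM2l ?normc_ge0.
Qed.

Lemma bounded_add S T : bounded_op S -> bounded_op T -> bounded_op (S + T).
Proof.
move=> hS hT; have [M M0 hM] := bounded_opP hS; have [N N0 hN] := bounded_opP hT.
split=> [a u v|].
  rewrite !fctE (bounded_lin hT) (bounded_lin hS).
  by rewrite scalerDr addrACA.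
exists (M + N) => h; rewrite fctE; apply: le_trans (hnorm_triangle _ _) _.
by rewrite mulrDl lerD.
Qed.

Lemma bounded_zero : bounded_op (0 : H -> H).
Proof.
split=> [a u v|]; first by change (0 = a *: (0 : H) + 0); rewrite scaler0 addr0.
by exists 0 => h; change (hnorm (0 : H) <= 0 * hnorm h); rewrite hnorm0 mul0r.
Qed.

Lemma opnorm_bound T : bounded_op T ->
  forall h, hnorm (T h) <= opnorm T * hnorm h.
Proof.
move=> hT h; have [M M0 hM] := bounded_opP hT.
(* A vector of norm zero cannot be normalised; the others are rescaled to the unit ball. *)
have [h0|h0] := eqVneq (hnorm h) 0.
  by have := hM h; rewrite h0 !mulr0.
have hp : 0 < hnorm h by rewrite lt_def h0 hnorm_ge0.
pose c := (hnorm h)^-1.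
have cp : 0 <= c by rewrite invr_ge0 hnorm_ge0.
have : hnorm (T (c%:C *: h)) <= opnorm T.
  apply: ub_le_sup.
    exists M => _ [g hg <-]; apply: le_trans (hM g) _.
    by rewrite -{2}(mulr1 M) ler_wpM2l.
  by exists (c%:C *: h) => //=; rewrite hnormZ normcR ger0_norm // mulVf.
rewrite (linZ (bounded_lin hT)) hnormZ normcR ger0_norm //.
by rewrite ler_pdivrMl // mulrC.
Qed.

Lemma opnorm_le T (M : R) : 0 <= M ->
  (forall h, hnorm (T h) <= M * hnorm h) -> opnorm T <= M.
Proof.
move=> M0 hM; apply: ge_sup; first by exists (hnorm (T 0)), 0; rewrite //= hnorm0.
move=> _ [g hg <-]; apply: le_trans (hM g) _.
by rewrite -{2}(mulr1 M) ler_wpM2l.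
Qed.

End HilbertNorm.

(** * Maximum principle *)

Section SecondOrderExpansion.
Context {R : realType} {H : hilbertType R}.
Implicit Types (w : R[i] -> H) (a z : R[i]).

(** Stands in for holomorphy at [a]. The cubic order of the remainder is what the strictness in
    [expandable_submean] rests on: an error of order t^3 loses against a gain of order t^2. *)
Definition expandable w a : Prop := exists (w1 w2 : H) (C e : R),
  [/\ 0 <= C, 0 < e & forall z, cn z <= e ->
    hnorm (w (a + z) - (w a + z *: w1 + z ^+ 2 *: w2)) <= C * cn z ^+ 3].

Lemma expandable_lipschitz w a : expandable w a ->
  exists D e : R, [/\ 0 <= D, 0 < e & forall z, cn z <= e ->
    hnorm (w (a + z) - w a) <= D * cn z].
Proof.
case=> w1 [w2 [C [e [C0 e0 hw]]]].
exists (C + hnorm w1 + hnorm w2), (Num.min e 1).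
split=> [||z]; first by rewrite !addr_ge0 ?hnorm_ge0.
  by rewrite lt_min e0 ltr01.
rewrite le_min => /andP[ze z1].
have z0 := normc_ge0 z.
have -> : w (a + z) - w a = (w (a + z) - (w a + z *: w1 + z ^+ 2 *: w2)) +
    (z *: w1 + z ^+ 2 *: w2).
  by rewrite -[w a + _ + _]addrA; move: (_ *: w1 + _) => q; rewrite opprD addrA addrNK.
apply: le_trans (hnorm_triangle _ _) _.
apply: le_trans (lerD (hw z ze) (hnorm_triangle _ _)) _.
rewrite !hnormZ normcX !mulrDl -addrA.
have z2 : cn z ^+ 2 <= cn z by rewrite expr2 ler_piMr.
apply: lerD; last by apply: lerD; rewrite mulrC ler_wpM2l ?hnorm_ge0.
rewrite ler_wpM2l // exprS; apply: le_trans (_ : cn z * cn z <= _).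
  by rewrite ler_wpM2l.
by rewrite -expr2.
Qed.

Lemma expandable_sub w v a : expandable w a -> expandable v a ->
  expandable (fun z => w z - v z) a.
Proof.
case=> w1 [w2 [C [e [C0 e0 hw]]]] [v1 [v2 [D [e' [D0 e'0 hv]]]]].
exists (w1 - v1), (w2 - v2), (C + D), (Num.min e e').
split=> [||z]; [exact: addr_ge0 | by rewrite lt_min e0 | ].
rewrite le_min => /andP[ze ze'].
rewrite mulrDl; apply: le_trans (lerD (hw _ ze) (hv _ ze')).
apply: le_trans (hnorm_triangleB _ _); rewrite le_eqVlt; apply/orP; left.
apply/eqP; congr hnorm; rewrite !scalerBr.
have : forall x y p q r s t u : H, x - y - (p - q + (r - s) + (t - u)) =
   x - (p + r + t) - (y - (q + s + u)).
  by move=> *; rewrite !opprD !opprK !addrA [LHS](ACl (1*3*5*7*2*4*6*8)).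
by apply.
Qed.

Lemma expandable_bounded_op (L : H -> H) w a : bounded_op L ->
  expandable w a -> expandable (fun z => L (w z)) a.
Proof.
move=> hL; have lL := bounded_lin hL; have [M M0 hM] := bounded_opP hL.
case=> w1 [w2 [C [e [C0 e0 hw]]]].
exists (L w1), (L w2), (M * C), e; split=> // [|z ze]; first exact: mulr_ge0.
rewrite -!(linZ lL) -!(linD lL) -(linB lL).
by apply: le_trans (hM _) _; rewrite -mulrA ler_wpM2l // hw.
Qed.

Lemma expandable_divX w a : a != 0 -> expandable w a ->
  expandable (fun z => z^-1 *: w z) a.
Proof.
move=> a0 [w1 [w2 [C [e [C0 e0 hw]]]]].
have ap : 0 < cn a by rewrite normc_gt0.
(* Coefficients of the quotient, found by comparing powers of [z] in (a + z)(v0 + z v1 + z^2 v2);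
   beyond the expansion of [w] only z^3 v2 is left over. *)
pose v0 := a^-1 *: w a; pose v1 := a^-1 *: (w1 - v0).
pose v2 := a^-1 *: (w2 - v1).
have e0' : a *: v0 = w a by rewrite scalerA divff // scale1r.
have e1 : w1 = a *: v1 + v0 by rewrite scalerA divff // scale1r addrNK.
have e2 : w2 = a *: v2 + v1 by rewrite scalerA divff // scale1r addrNK.
clearbody v0 v1 v2.
have V0 : a^-1 *: w a = v0 by rewrite -e0' scalerA mulVf // scale1r.
(* For |z| <= |a|/2 one has |a + z| >= |a|/2, whence the factor 2/|a|. *)
exists v1, v2, ((C + hnorm v2) * (2 / cn a)), (Num.min e (cn a / 2)).
split=> [||z]; first by rewrite !mulr_ge0 ?addr_ge0 ?hnorm_ge0 // invr_ge0 ltW.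
  by rewrite lt_min e0 divr_gt0.
rewrite le_min => /andP[ze za].
have az : cn a / 2 <= cn (a + z).
  have := normcD (a + z) (- z); rewrite addrK.
  rewrite normcN.
  by move: za; lra.
have azp : 0 < cn (a + z) by apply: lt_le_trans az; rewrite divr_gt0.
have az0 : a + z != 0 by rewrite -normc_gt0.
have -> : (a + z)^-1 *: w (a + z) - (a^-1 *: w a + z *: v1 + z ^+ 2 *: v2) =
   (a + z)^-1 *: (w (a + z) - (w a + z *: w1 + z ^+ 2 *: w2) - z ^+ 3 *: v2).
  rewrite V0; apply: (scalerI az0); rewrite scalerBr !scalerA divff // !scale1r.
  rewrite -[RHS]addrA -opprD; congr (_ - _).
  rewrite -e0' e1 e2.
  rewrite !scalerDr !scalerA !mulrDl !scalerDl !addrA [LHS](ACl (1*3*2*5*4*6)).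
  by rewrite [a * z]mulrC [a * z ^+ 2]mulrC -expr2 -exprS.
rewrite hnormZ Normc.normcV.
apply: le_trans (_ : (2 / cn a) * ((C + hnorm v2) * cn z ^+ 3) <= _); last first.
  by rewrite mulrCA mulrA.
apply: ler_pM; rewrite ?invr_ge0 ?normc_ge0 ?hnorm_ge0 //.
  by rewrite -[2 / cn a]invf_div lef_pV2 // posrE divr_gt0.
apply: le_trans (hnorm_triangleB _ _) _.
by rewrite mulrDl hnormZ normcX [hnorm v2 * _]mulrC lerD2r hw.
Qed.

Lemma normc_sqr z : cn z ^+ 2 = complex.Re z ^+ 2 + complex.Im z ^+ 2.
Proof. by case: z => x y /=; rewrite sqr_sqrtr // addr_ge0 ?sqr_ge0. Qed.

(** The annulus is closed and lies in a square; working in [R * R] lets a product of segments serve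
    as the compact set. *)
Lemma compact_annulus (s t : R) :
  compact [set p : R * R | s <= p.1 ^+ 2 + p.2 ^+ 2 <= t].
Proof.
have cont : continuous (fun p : R * R => p.1 ^+ 2 + p.2 ^+ 2).
  by move=> p; apply: cvgD; apply: cvgM; (exact: cvg_fst || exact: cvg_snd).
pose M := 1 + `|t|.
apply: (@subclosed_compact _ _ (`[- M, M] `*` `[- M, M])).
- have -> : [set p : R * R | s <= p.1 ^+ 2 + p.2 ^+ 2 <= t] =
     (fun p : R * R => p.1 ^+ 2 + p.2 ^+ 2) @^-1` `[s, t].
    by apply/seteqP; split=> p /=; rewrite in_itv.
  by apply: closed_comp => [p _|]; [exact: cont|exact: itv_closed].
- by apply: compact_setX; exact: segment_compact.
- have key : forall x y : R, x ^+ 2 + y ^+ 2 <= t -> - M <= x <= M.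
    move=> x y xt; rewrite -ler_norml; have := ler_norm t; rewrite /M.
    rewrite leNgt => tt; apply/negP => lt.
    have : `|x| ^+ 2 = x ^+ 2 by rewrite real_normK ?num_real.
    have := sqr_ge0 y; move: lt tt xt; rewrite -leNgt.
    have := normr_ge0 t; nra.
  move=> [x y] /= /andP[_ h]; rewrite !in_itv /=; split; first exact: key h.
  by rewrite addrC in h; exact: key h.
Qed.

Lemma continuous_expandable w (p : R * R) :
  expandable w (p.1 +i* p.2)%C ->
  {for p, continuous (fun q : R * R => hnorm (w (q.1 +i* q.2)%C))}.
Proof.
move=> /expandable_lipschitz[D [e [D0 e0 hw]]]; apply/cvgrPdist_le => /= x x0.
pose r := Num.min (e / 2) (x / (D + 1) / 2).
have D1 : 0 < D + 1 by lra.
have r0 : 0 < r by rewrite lt_min !divr_gt0.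
apply/(@nbhs_ballP R (R * R)%type); exists r => // -[q1 q2] /= [b1 b2].
rewrite /ball /= in b1 b2.
set z := ((q1 - p.1) +i* (q2 - p.2))%C.
have zE : (q1 +i* q2)%C = (p.1 +i* p.2)%C + z.
  by rewrite /z; simpc; rewrite !subrKC.
have zr : cn z <= r + r.
  have -> : z = (q1 - p.1)%:C + (0 +i* (q2 - p.2))%C by rewrite /z; simpc.
  apply: le_trans (normcD _ _) _; rewrite normcR /= expr0n /= add0r sqrtr_sqr.
  by apply: lerD; rewrite distrC ltW.
have ze : cn z <= e.
  apply: le_trans zr _.
  have : r <= e / 2 by rewrite ge_min lexx.
  lra.
have h1 : hnorm (w (p.1 +i* p.2)%C) <= hnorm (w (q1 +i* q2)%C) + D * cn z.
  rewrite zE -lerBlDl; apply: le_trans (hw z ze).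
  rewrite lerBlDl; apply: le_trans (hnorm_triangleB _ _).
  by rewrite opprB addrC addrNK.
have h2 : hnorm (w (q1 +i* q2)%C) <= hnorm (w (p.1 +i* p.2)%C) + D * cn z.
  rewrite zE -lerBlDl; apply: le_trans (hw z ze).
  rewrite lerBlDl; apply: le_trans (hnorm_triangle _ _).
  by rewrite subrKC.
have h3 : D * cn z <= x.
  apply: le_trans (ler_wpM2l D0 zr) _.
  have : r <= x / (D + 1) / 2 by rewrite ge_min lexx orbT.
  move=> rx; apply: le_trans (_ : D * (x / (D + 1)) <= _).
    by apply: ler_wpM2l => //; lra.
  rewrite mulrA ler_pdivrMr //; nra.
by rewrite ler_norml; apply/andP; split; lra.
Qed.

(* The four values at [a + z] with [z = t, -t, it, -it] average the first- and
   second-order terms away, by the parallelogram law. *)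
Lemma expandable_submean w a (eps : R) : expandable w a -> 0 < eps ->
  exists2 e : R, 0 < e & forall t : R, 0 < t -> t <= e ->
  exists2 z, cn z = t & hnorm (w a) ^+ 2 + eps * cn a ^+ 2 <
    hnorm (w (a + z)) ^+ 2 + eps * cn (a + z) ^+ 2.
Proof.
case=> w1 [w2 [C [e [C0 e0 hw]]]] eps0.
pose P := hnorm (w a) + hnorm w1 + hnorm w2.
have P0 : 0 <= P by rewrite !addr_ge0 ?hnorm_ge0.
have PC : 0 <= P * C by exact: mulr_ge0.
(* Makes 2 P C t < eps, so the cubic error stays below the gain eps t^2. *)
pose e' := Num.min e (Num.min 1 (eps / (2 * (P * C) + 1))).
exists e' => [|t t0].
  by rewrite !lt_min e0 ltr01 divr_gt0 //; lra.
rewrite !le_min => /and3P[te t1 tp].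
have tP : 2 * (P * C) * t < eps.
  by move: tp; rewrite ler_pdivlMr; nra.
apply: contrapT => noz.
have le_u z : cn z = t -> hnorm (w (a + z)) ^+ 2 + eps * cn (a + z) ^+ 2 <=
    hnorm (w a) ^+ 2 + eps * cn a ^+ 2.
  by move=> zt; rewrite leNgt; apply/negP => ?; apply: noz; exists z.
(* Squaring |p| <= |w (a + z)| + C t^3 costs at most 2 |p| C t^3 <= 2 P C t^3. *)
have le_p z : cn z = t -> hnorm (w a + z ^+ 2 *: w2 + z *: w1) ^+ 2 -
    2 * (P * C) * t ^+ 3 <= hnorm (w (a + z)) ^+ 2.
  move=> zt; rewrite addrAC; set p := w a + _ + _.
  have h1 : hnorm p <= P.
    apply: le_trans (hnorm_triangle _ _) _; apply: lerD.
      apply: le_trans (hnorm_triangle _ _) _; rewrite lerD2l hnormZ zt.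
      by rewrite ler_piMl ?hnorm_ge0.
    by rewrite hnormZ normcX zt ler_piMl ?hnorm_ge0 // expr_le1 // ltW.
  have h2 : hnorm p <= hnorm (w (a + z)) + C * t ^+ 3.
    have := hw z; rewrite zt => /(_ te); rewrite -/p => h.
    apply: le_trans (lerD (lexx _) h); apply: le_trans (hnorm_triangleB _ _).
    by rewrite opprB addrC addrNK.
  have h3 := hnorm_ge0 p; have h4 := hnorm_ge0 (w (a + z)).
  have h5 : 0 <= C * t ^+ 3 by rewrite mulr_ge0 // exprn_ge0 // ltW.
  move: h1 h2 h3 h4 h5; rewrite -mulrA -[P * C * _]mulrA.
  move: (hnorm p) (hnorm (w (a + z))) (C * _) => x y q h1 h2 h3 h4 h5.
  have h6 : x * q <= P * q by rewrite ler_wpM2r.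
  have [xq|qx] := leP x q.
    have : x * x <= x * q by rewrite ler_wpM2l.
    by rewrite !expr2; have := mulr_ge0 h4 h4; have := mulr_ge0 h3 h5; lra.
  have : (x - q) ^+ 2 <= y ^+ 2 by rewrite ler_pXn2r ?nnegrE //; lra.
  by rewrite sqrrB; have := sqr_ge0 q; lra.
have ct : cn t%:C = t by rewrite normcR gtr0_norm.
have cnt : cn (- t%:C) = t by rewrite normcN.
have cit : cn ('i%C * t%:C) = t.
  by rewrite Normc.normcM ct /= expr0n expr1n /= add0r sqrtr1 mul1r.
have cint : cn (- ('i%C * t%:C)) = t by rewrite normcN.
have := le_u _ ct; have := le_p _ ct; have := le_u _ cnt; have := le_p _ cnt.
have := le_u _ cit; have := le_p _ cit; have := le_u _ cint; have := le_p _ cint.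
rewrite !sqrrN !exprMn sqr_i mulN1r.
(* Each of the first two laws treats one pair of opposite points; as (it)^2 = -t^2, the third
   recombines w a + t^2 w2 and w a - t^2 w2. *)
have hpar1 := parallelogram (w a + t%:C ^+ 2 *: w2) (t%:C *: w1).
have hpar2 := parallelogram (w a - t%:C ^+ 2 *: w2) (('i%C * t%:C) *: w1).
have hpar3 := parallelogram (w a) (t%:C ^+ 2 *: w2).
rewrite !scaleNr.
(* The quadratic weight gains exactly eps t^2 on average, which makes the submean inequality
   strict. *)
have : eps * cn (a + t%:C) ^+ 2 + eps * cn (a - t%:C) ^+ 2 +
    eps * cn (a + 'i%C * t%:C) ^+ 2 + eps * cn (a - 'i%C * t%:C) ^+ 2 =
    4 * (eps * cn a ^+ 2) + 4 * (eps * t ^+ 2).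
  by case: (a) => x y; rewrite !normc_sqr /=; ring.
move: hpar1 hpar2 hpar3.
have t3 : 2 * (P * C) * t ^+ 3 < eps * t ^+ 2.
  by rewrite exprSr mulrCA [eps * _]mulrC ltr_pM2l ?exprn_gt0.
have := sqr_ge0 (hnorm (t%:C *: w1)).
have := sqr_ge0 (hnorm (('i%C * t%:C) *: w1)).
have := sqr_ge0 (hnorm (t%:C ^+ 2 *: w2)).
lra.
Qed.


(** On the compact annulus |w|^2 + eps |a|^2 attains its maximum; by [expandable_submean] this
    happens on a boundary circle. Then eps tends to 0. *)
Lemma maximum_annulus w (r s B : R) : 0 < r ->
  (forall a, r <= cn a <= s -> expandable w a) ->
  (forall a, cn a = r -> hnorm (w a) <= B) ->
  (forall a, cn a = s -> hnorm (w a) <= B) ->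
  forall a, r <= cn a <= s -> hnorm (w a) <= B.
Proof.
move=> r0 hw hr hs a0 ha0.
have rs : r <= s by case/andP: ha0 => h1 h2; exact: le_trans h2.
have s0 : 0 < s by exact: lt_le_trans rs.
have B0 : 0 <= B.
  by apply: le_trans (hnorm_ge0 _) (hr r%:C _); rewrite normcR gtr0_norm.
suff key (eps : R) : 0 < eps -> hnorm (w a0) ^+ 2 <= B ^+ 2 + eps * s ^+ 2.
  rewrite -(@ler_pXn2r _ 2) ?nnegrE ?hnorm_ge0 //.
  apply/ler_addgt0Pr => e e0; have := key (e / s ^+ 2).
  by rewrite divfK ?expf_neq0 ?gt_eqF // divr_gt0 ?exprn_gt0 //; exact.
move=> eps0.
pose u a := hnorm (w a) ^+ 2 + eps * cn a ^+ 2.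
pose K := [set p : R * R | r ^+ 2 <= p.1 ^+ 2 + p.2 ^+ 2 <= s ^+ 2].
have KE x y : K (x, y) = (r <= cn (x +i* y)%C <= s) :> Prop.
  change ((r ^+ 2 <= x ^+ 2 + y ^+ 2 <= s ^+ 2) = (r <= cn (x +i* y)%C <= s) :> Prop).
  have <- : cn (x +i* y)%C ^+ 2 = x ^+ 2 + y ^+ 2 by exact: normc_sqr.
  by rewrite !ler_pXn2r ?nnegrE ?normc_ge0 ?(ltW r0) ?(ltW s0).
have contu : {within K, continuous (fun p : R * R => u (p.1 +i* p.2)%C)}.
  apply: continuous_in_subspaceT => -[x y]; rewrite inE KE => /hw hp.
  have cw := continuous_expandable (p := (x, y)) hp.
  rewrite /u; under eq_fun do rewrite normc_sqr /=.
  apply: cvgD; first by apply: cvgM; exact: cw.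
  apply: cvgM; first exact: cvg_cst.
  by apply: cvgD; apply: cvgM; (exact: cvg_fst || exact: cvg_snd).
have Kn : K !=set0.
  by move: ha0; case: (a0) => x y h; exists (x, y); rewrite KE.
have cK : compact K by exact: compact_annulus.
have [[x y] /[!inE] Kxy hmax] := compact_EVT_max Kn cK contu.
have umax a : r <= cn a <= s -> u a <= u (x +i* y)%C.
  by case: a => x' y' h; apply: (hmax (x', y')); rewrite inE KE.
move: Kxy umax; rewrite KE; move: (x +i* y)%C => b hb umax.
suff ub : u b <= B ^+ 2 + eps * s ^+ 2.
  apply: le_trans (le_trans (umax _ ha0) ub).
  by rewrite lerDl mulr_ge0 ?sqr_ge0 // ltW.
have bd : cn b = r \/ cn b = s -> u b <= B ^+ 2 + eps * s ^+ 2.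
  move=> hbd; apply: lerD.
    by rewrite ler_pXn2r ?nnegrE ?hnorm_ge0 //; case: hbd; [exact: hr|exact: hs].
  rewrite ler_wpM2l ?(ltW eps0) // ler_pXn2r ?nnegrE ?normc_ge0 ?(ltW s0) //.
  by case/andP: hb.
case/andP: (hb) => h1 h2.
have [e1|n1] := eqVneq (cn b) r; first by apply: bd; left.
have [e2|n2] := eqVneq (cn b) s; first by apply: bd; right.
have {h1 n1} h1 : r < cn b by rewrite lt_neqAle eq_sym n1.
have {h2 n2} h2 : cn b < s by rewrite lt_neqAle n2.
have [e e0 he] := expandable_submean (hw b hb) eps0.
(* A circle this small around [b] stays inside the annulus, where [b] is maximal. *)
pose t := Num.min e (Num.min (cn b - r) (s - cn b)).
have [||z zt] := he t; first by rewrite !lt_min e0 !subr_gt0 h1.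
  by rewrite ge_min lexx.
rewrite ltNge => /negP[]; apply: umax.
have := normcD b z; have := normcD (b + z) (- z); rewrite addrK normcN zt.
have : t <= cn b - r by rewrite !ge_min lexx !orbT.
have : t <= s - cn b by rewrite !ge_min lexx !orbT.
by move=> *; apply/andP; split; lra.
Qed.

(** The maximum principle for g(a)/a^n: the bound becomes [eta] on the inner circle and M/s^n on the
    outer one, and the latter is small for large [n] when s > 1. *)
Lemma three_circles (g : R[i] -> H) (r s M eta : R) (n : nat) :
  0 < r -> r <= 1 -> 1 <= s ->
  (forall a, r <= cn a <= s -> expandable g a) ->
  (forall a, cn a = r -> hnorm (g a) <= eta * r ^+ n) ->
  (forall a, cn a = s -> hnorm (g a) <= M) ->
  hnorm (g 1) <= Num.max eta (M / s ^+ n).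
Proof.
move=> r0 r1 s1 hg hr hs.
have s0 : 0 < s by exact: lt_le_trans s1.
pose w a := (a ^+ n)^-1 *: g a.
have -> : g 1 = w 1 by rewrite /w expr1n invr1 scale1r.
have wE a : hnorm (w a) = hnorm (g a) / cn a ^+ n.
  by rewrite hnormZ Normc.normcV normcX mulrC.
apply: (maximum_annulus r0 _ _ _ (_ : r <= cn 1 <= s)).
- move=> a ha; rewrite /w; have a0 : a != 0.
    by rewrite -normc_gt0; apply: lt_le_trans (_ : r <= _) => //; case/andP: ha.
  elim: n {hr wE w} => [|m ih].
    by under [X in expandable X]eq_fun do rewrite expr0 invr1 scale1r; exact: hg.
  under [X in expandable X]eq_fun do rewrite exprS invfM -scalerA.
  exact: expandable_divX.
- move=> a ha; rewrite wE ha ler_pdivrMr ?exprn_gt0 //.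
  by apply: le_trans (hr a ha) _; rewrite ler_wpM2r ?exprn_ge0 ?(ltW r0) // le_max lexx.
- move=> a ha; rewrite wE ha le_max; apply/orP; right.
  by rewrite ler_pM2r ?invr_gt0 ?exprn_gt0 // hs.
- by rewrite Normc.normc1 r1.
Qed.

End SecondOrderExpansion.

(** Compactness of the disc in the form of a near covering: the bound is taken near +oo, so the
    local bounds combine into one. *)
Lemma locally_bounded_disc (R : realType) (f : R[i] -> R) (s : R) :
  (forall a, cn a <= s -> exists e M : R, 0 < e /\
    forall z, cn z <= e -> f (a + z) <= M) ->
  exists M : R, forall a, cn a <= s -> f a <= M.
Proof.
move=> hf.
have [s0|s0] := leP 0 s; last first.
  exists 0 => a ha; have := le_lt_trans ha s0.
  by rewrite ltNge normc_ge0.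
pose K := [set p : R * R | 0 <= p.1 ^+ 2 + p.2 ^+ 2 <= s ^+ 2].
have cK : near_covering K.
  by apply/compact_near_coveringP; exact: compact_annulus.
have : \forall M \near +oo, K `<=` (fun p => f (p.1 +i* p.2)%C <= M).
  apply: cK => -[x y] /= /andP[_ xy].
  have /hf[e [M [e0 hM]]] : cn (x +i* y)%C <= s.
    by rewrite -(@ler_pXn2r _ 2) ?nnegrE ?normc_ge0 // normc_sqr.
  exists (ball (x, y) (e / 2), [set N | M <= N]) => /=.
    split; first by apply: nbhsx_ballx; rewrite divr_gt0.
    by exists M; split; [exact: num_real|move=> N /ltW].
  move=> [[x' y'] N] /= [[b1 b2] MN]; apply: le_trans MN.
  rewrite /ball /= in b1 b2.
  have -> : (x' +i* y')%C = (x +i* y)%C + ((x' - x) +i* (y' - y))%C.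
    by simpc; rewrite !subrKC.
  apply: hM.
  have -> : ((x' - x) +i* (y' - y))%C = (x' - x)%:C + (0 +i* (y' - y))%C by simpc.
  apply: le_trans (normcD _ _) _; rewrite normcR /= expr0n /= add0r sqrtr_sqr.
  by rewrite (splitr e); apply: lerD; rewrite distrC ltW.
move=> [M [_ hM]]; exists (M + 1) => a ha.
have := hM (M + 1); rewrite ltrDl ltr01 => /(_ isT (complex.Re a, complex.Im a)) /=.
have -> : (complex.Re a +i* complex.Im a)%C = a by case: (a).
apply.
by rewrite /K /= -normc_sqr sqr_ge0 /= ler_pXn2r ?nnegrE ?normc_ge0.
Qed.

(** * Finite direct sums *)

Section FiniteUnitary.
Context {R : realType} {H : hilbertType R} {n : nat}.
Context {U : ('I_n -> H) -> H} {Us : H -> ('I_n -> H)}.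
Context (hU : unitary_from_fin U Us).
Implicit Types (v : 'I_n -> H) (h : H).

Lemma ufinK v : Us (U v) = v.
Proof. exact: (unitary_adjK hU). Qed.

Lemma ufinVK h : U (Us h) = h.
Proof. exact: (unitaryK hU). Qed.

Lemma ufin_linear : linear U.
Proof. by move=> a u v; apply: (unitary_linear hU). Qed.

Lemma ufinV_linear : linear Us.
Proof.
move=> a h k; rewrite -[RHS]ufinK; congr Us.
by rewrite ufin_linear !ufinVK.
Qed.

Lemma ufin_norm v : hnorm (U v) ^+ 2 = \sum_i hnorm (v i) ^+ 2.
Proof.
apply: complexI; rewrite -inner_hnorm (unitary_adjoint hU) // ufinK.
by rewrite /inner_fin rmorph_sum; apply: eq_bigr => i _; rewrite inner_hnorm.
Qed.

Lemma ufinV_norm h i : hnorm (Us h i) <= hnorm h.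
Proof.
rewrite -(@ler_pXn2r _ 2) ?nnegrE ?hnorm_ge0 // -[h in leRHS]ufinVK ufin_norm.
by rewrite (bigD1 i) //= lerDl sumr_ge0 // => j _; rewrite sqr_ge0.
Qed.

Lemma ufin_norm_le v : hnorm (U v) <= \sum_i hnorm (v i).
Proof.
have s0 : 0 <= \sum_i hnorm (v i) by apply: sumr_ge0 => i _; exact: hnorm_ge0.
rewrite -(@ler_pXn2r _ 2) ?nnegrE ?hnorm_ge0 // ufin_norm expr2 mulr_suml.
apply: ler_sum => i _; rewrite expr2 ler_wpM2l ?hnorm_ge0 //.
rewrite (bigD1 i) //= lerDl sumr_ge0 // => j _; exact: hnorm_ge0.
Qed.

(** Intertwiners into matrix points are columns of bounded operators; transport by [U] puts them in
    B(H). *)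
Lemma bounded_column (G : 'I_n -> H -> H) : (forall i, bounded_op (G i)) ->
  bounded_op (fun h => U (G^~ h)).
Proof.
move=> hG; split=> [a u v|].
  rewrite -ufin_linear; congr U; apply/funext => i /=.
  exact: (bounded_lin (hG i)).
have /choice[M hM] : forall i, exists M : R, forall h, hnorm (G i h) <= M * hnorm h.
  by move=> i; have [M _ ?] := bounded_opP (hG i); exists M.
exists (\sum_i M i) => h; apply: le_trans (ufin_norm_le _) _.
by rewrite mulr_suml; apply: ler_sum.
Qed.

Lemma bounded_coord i : bounded_op (fun h => Us h i).
Proof.
split=> [a u v|]; first by rewrite ufinV_linear.
by exists 1 => h; rewrite mul1r ufinV_norm.
Qed.

End FiniteUnitary.

Lemma bounded_sum (R : realType) (H : hilbertType R) (I : Type) (s : seq I)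
  (P : pred I) (T : I -> H -> H) : (forall i, bounded_op (T i)) ->
  bounded_op (fun h => \sum_(i <- s | P i) T i h).
Proof.
move=> hT; have -> : (fun h => \sum_(i <- s | P i) T i h) = \sum_(i <- s | P i) T i.
  by apply/funext => h; rewrite fct_sumE.
by elim/big_ind: _ => // [|S S']; [exact: bounded_zero|exact: bounded_add].
Qed.

(** * Noncommutative functions at matrix points *)

Lemma cvg_hnormP (R : realType) (H : hilbertType R) (u : nat -> H) (l : H) :
  u @ \oo --> l <-> forall e : R, 0 < e ->
    exists N, forall j, (N <= j)%N -> hnorm (u j - l) <= e.
Proof.
split=> [/cvgrPdist_le hu e e0|hu].
  have [|N _ hN] := hu e%:C; first by rewrite ltcR.
  by exists N => j /hN /=; rewrite normE lecR -hnorm_opp opprB.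
apply/cvgrPdist_le => e; rewrite ltcE /= => /andP[/eqP im0 re0].
have [N hN] := hu (complex.Re e) re0.
exists N => // j /= /hN; rewrite -hnorm_opp opprB -lecR -normE => /le_trans; apply.
by rewrite lecE /= im0 eqxx lexx.
Qed.

Section MatrixPoints.
Context {R : realType} {H : hilbertType R}.
Context {A : set (H -> H)} (hA : unital_closed_subalgebra A).
Context {U : forall n : nat, ('I_n -> H) -> H}.
Context {Us : forall n : nat, H -> ('I_n -> H)}.
Arguments U : clear implicits.
Arguments Us : clear implicits.
Context (hU : direct_sum_property A U Us).
Context {d : nat}.
Local Notation tup := ('I_d -> H -> H).
Context {Omega : set tup} (hOmega : nc_domain A U Us Omega).
Context {F : tup -> H -> H} (hF : nc_function Omega F).
Implicit Types (x y : tup) (h : H) (a b c z : R[i]).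

Lemma direct_sum_unitary n : (0 < n)%N -> unitary_from_fin (U n) (Us n).
Proof. by move=> n0; have [] := hU n0. Qed.

Lemma omega_bounded x r : Omega x -> bounded_op (x r).
Proof. by move=> /(nc_domain_sub hOmega)/(_ r)/(subalg_bounded hA). Qed.

Lemma tpow_scale a x : tpow A x -> tpow A (a *: x).
Proof. by move=> hx r; apply: (subalg_scale hA); exact: hx. Qed.

Lemma tuple_bound x : tpow A x ->
  exists2 K : R, 0 < K & forall r h, hnorm (x r h) <= K * hnorm h.
Proof.
move=> Ax; have /choice[K hK] r : exists K : R, 0 <= K /\
    forall h, hnorm (x r h) <= K * hnorm h.
  by have [K K0 ?] := bounded_opP (subalg_bounded hA (Ax r)); exists K.
have K0 r : 0 <= K r by have [] := hK r.
exists (1 + \sum_r K r); first by rewrite ltr_pwDl // sumr_ge0.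
move=> r h; apply: le_trans (proj2 (hK r) h) _; rewrite ler_wpM2r ?hnorm_ge0 //.
by rewrite (bigD1 r) //= addrCA lerDl addr_ge0 // sumr_ge0.
Qed.

(** Openness of [Omega] and local boundedness of [F] share one radius here, and closeness is
    pointwise, so that it can be checked without suprema. *)
Lemma nc_locally_bounded x : Omega x -> exists e M : R, [/\ 0 < e, 0 <= M &
  forall y, tpow A y -> (forall r h, hnorm (y r h - x r h) <= e * hnorm h) ->
  Omega y /\ forall h, hnorm (F y h) <= M * hnorm h].
Proof.
move=> Ox; have [_ [e e0 he]] := nc_domain_open hOmega Ox.
have [e' e'0 [M hM]] := nc_function_locally_bounded hF Ox.
pose m := Num.min e e'; have m0 : 0 < m by rewrite lt_min e0.
(* Halving the common radius turns non-strict pointwise bounds into the strict inequality of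
   [tball]. *)
exists (m / 2), `|M|; split=> [||y Ay yx]; [by rewrite divr_gt0| by []|].
have ball r : opnorm (y r - x r) < m.
  apply: le_lt_trans (_ : m / 2 < m); last by lra.
  by apply: opnorm_le => [|h]; [rewrite divr_ge0 // ltW | exact: yx].
have Oy : Omega y.
  apply: he; split=> // r; apply: lt_le_trans (ball r) _.
  by rewrite ge_min lexx.
split=> // h; apply: le_trans (opnorm_bound (nc_function_bounded_op hF Oy) h) _.
rewrite ler_wpM2r ?hnorm_ge0 //; apply: le_trans (ler_norm M); apply: hM => // r.
by apply: lt_le_trans (ball r) _; rewrite ge_min lexx orbT.
Qed.

(* [mxtup S y] is the point [S (x) y], moved from [H^(n)] to [H] by [U n];
   [Fmx S y] is the value of [F] there, moved back to [H^(n)]. *)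
Definition mxtup n (S : 'I_d -> 'M[R[i]]_n) y : tup :=
  fun r => U n \o opmx (\matrix_(i, j) (S r i j *: y r)) \o Us n.

Definition Fmx n (S : 'I_d -> 'M[R[i]]_n) y (v : 'I_n -> H) : 'I_n -> H :=
  Us n (F (mxtup S y) (U n v)).

Lemma mxtupE n (S : 'I_d -> 'M[R[i]]_n) y r h :
  mxtup S y r h = U n (fun i => \sum_j S r i j *: y r (Us n h j)).
Proof.
congr (U n); apply/funext => i; apply: eq_bigr => j _.
by rewrite mxE.
Qed.

Lemma mxtup_tpow n (S : 'I_d -> 'M[R[i]]_n) y : (0 < n)%N ->
  (forall r (i j : 'I_n), (j < i)%N -> S r i j = 0) -> tpow A y -> tpow A (mxtup S y).
Proof.
move=> n0 hS hy r; have [_] := hU n0; apply => i j; rewrite mxE.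
case: ifP => [ji|_]; first by rewrite hS // scale0r.
by apply: (subalg_scale hA); exact: hy.
Qed.

(** Transport by [U n] and [U m] makes [L] an operator on [H] that intertwines the two points, hence
    also the values of [F]. *)
Lemma Fmx_intertwine m n (S : 'I_d -> 'M[R[i]]_n) y (S' : 'I_d -> 'M[R[i]]_m) y'
    (L : ('I_n -> H) -> 'I_m -> H) : (0 < n)%N -> (0 < m)%N ->
  Omega (mxtup S y) -> Omega (mxtup S' y') ->
  (forall i, bounded_op (fun h => L (Us n h) i)) ->
  (forall r v, L (fun i => \sum_j S r i j *: y r (v j)) =
    fun i => \sum_j S' r i j *: y' r (L v j)) ->
  forall v, L (Fmx S y v) = Fmx S' y' (L v).
Proof.
move=> n0 m0 O1 O2 hL hLS v.
have bL := bounded_column (direct_sum_unitary m0) hL.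
have := nc_function_intertwining hF O1 O2 bL.
have inter r : (fun h => U m (L (Us n h))) \o mxtup S y r =
    mxtup S' y' r \o (fun h => U m (L (Us n h))).
  apply/funext => h; rewrite /= !mxtupE (ufinK (direct_sum_unitary n0)) hLS.
  by rewrite (ufinK (direct_sum_unitary m0)).
move=> /(_ inter)/(congr1 (fun f => f (U n v))) /=.
rewrite (ufinK (direct_sum_unitary n0)) => /(congr1 (Us m)).
by rewrite (ufinK (direct_sum_unitary m0)).
Qed.

Lemma Fmx_column n (S : 'I_d -> 'M[R[i]]_n) y x (G : 'I_n -> H -> H) :
  (0 < n)%N -> Omega (mxtup S y) -> Omega x ->
  (forall i, bounded_op (G i)) ->
  (forall r i h, G i (x r h) = \sum_j S r i j *: y r (G j h)) ->
  forall h, Fmx S y (G^~ h) = G^~ (F x h).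
Proof.
move=> n0 O1 O2 hG hGS h.
have := nc_function_intertwining hF O2 O1 (bounded_column (direct_sum_unitary n0) hG).
have inter r : (fun h => U n (G^~ h)) \o x r = mxtup S y r \o (fun h => U n (G^~ h)).
  apply/funext => k; rewrite /= mxtupE (ufinK (direct_sum_unitary n0)); congr (U n).
  by apply/funext => i.
move=> /(_ inter)/(congr1 (fun f => f h)) /= /(congr1 (Us n)).
by rewrite (ufinK (direct_sum_unitary n0)).
Qed.

(** * Matrix entries, bidiagonal points and Taylor expansion *)

Definition single n (j : 'I_n) h : 'I_n -> H := fun i => if i == j then h else 0.

Lemma U_single n (j : 'I_n) h : (0 < n)%N -> hnorm (U n (single j h)) = hnorm h.
Proof.
move=> n0; apply/eqP; rewrite -(@eqrXn2 _ 2) ?hnorm_ge0 //.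
rewrite (ufin_norm (direct_sum_unitary n0)) (bigD1 j) //= big1 => [|i /negPf ij].
  by rewrite /single eqxx addr0.
by rewrite /single ij hnorm0 expr0n.
Qed.

Lemma Fmx_linear n (S : 'I_d -> 'M[R[i]]_n) y : (0 < n)%N ->
  Omega (mxtup S y) -> linear (Fmx S y).
Proof.
move=> n0 O1 a u v; rewrite /Fmx (ufin_linear (direct_sum_unitary n0)).
rewrite (bounded_lin (nc_function_bounded_op hF O1)).
exact: (ufinV_linear (direct_sum_unitary n0)).
Qed.

Lemma sum_single n (v : 'I_n -> H) : v = \sum_j single j (v j).
Proof.
apply/funext => i; rewrite fct_sumE (bigD1 i) //= big1 => [|j /negPf ij].
  by rewrite /single eqxx addr0.
by rewrite /single eq_sym ij.
Qed.

Lemma singleZ n (j : 'I_n) a h : single j (a *: h) = a *: single j h.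
Proof.
apply/funext => i; rewrite scalrfctE /single.
by case: eqP => // _; rewrite scaler0.
Qed.

Lemma Fmx_single_bound n (S : 'I_d -> 'M[R[i]]_n) y (M : R) : (0 < n)%N ->
  (forall h, hnorm (F (mxtup S y) h) <= M * hnorm h) ->
  forall i j h, hnorm (Fmx S y (single j h) i) <= M * hnorm h.
Proof.
move=> n0 hM i j h; apply: le_trans (ufinV_norm (direct_sum_unitary n0) _ _) _.
by apply: le_trans (hM _) _; rewrite U_single.
Qed.

Lemma bounded_single n (j : 'I_n) i : bounded_op (fun h => single j h i).
Proof.
rewrite /single; case: eqP => _; [exact: bounded_id|exact: bounded_zero].
Qed.

(** A Jordan-type block of size n + 1 for [a], with superdiagonal [c] and the last eigenvalue moved
    to [b]. *)
Definition bidiag n a b c : 'M[R[i]]_n.+1 := \matrix_(i, j)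
  if i == j then (if i == n :> nat then b else a)
  else if i.+1 == j :> nat then c else 0.

Lemma bidiag_upper n a b c (i j : 'I_n.+1) : (j < i)%N -> bidiag n a b c i j = 0.
Proof.
move=> ji; rewrite mxE; case: eqP => [ij|_]; first by rewrite ij ltnn in ji.
by case: eqP => // ij; rewrite -ij ltnNge leqnSn in ji.
Qed.

(** [f] is indexed by natural numbers so that the shifted term makes sense in every row; the test
    cuts it off in the last one. *)
Lemma bidiag_row n a b c (i : 'I_n.+1) (f : nat -> H) :
  \sum_(j < n.+1) bidiag n a b c i j *: f j =
  (if i == n :> nat then b else a) *: f i + (if (i < n)%N then c *: f i.+1 else 0).
Proof.
rewrite (bigD1 i) //= mxE eqxx; congr (_ + _).
case: ifP => [lt_in|/negbT ge_in].
  have lt' : (i.+1 < n.+1)%N by [].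
  rewrite (bigD1 (Ordinal lt')) /=; last by rewrite -val_eqE /= gtn_eqF.
  rewrite mxE /= eqxx -val_eqE /= ltn_eqF // big1 ?addr0 // => j /andP[ji jS].
  rewrite mxE eq_sym (negPf ji); case: eqP => [e|]; last by rewrite scale0r.
  by move: jS; rewrite -val_eqE /= e eqxx.
rewrite big1 // => j ji; rewrite mxE eq_sym (negPf ji); case: eqP => [e|].
  by have := ltn_ord j; rewrite -e ltnS (negPf ge_in).
by rewrite scale0r.
Qed.

(** The column g_i = (c/z)^(n-i) satisfies c g_(i+1) = z g_i, so it is an eigenvector for a + z.
    Dividing the first row of the intertwining relation by (c/z)^n leaves the powers (z/c)^j. *)
Lemma bidiag_eigen n a z c x h : z != 0 -> c != 0 ->
  Omega ((a + z) *: x) -> Omega (mxtup (fun=> bidiag n a (a + z) c) x) ->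
  (forall r, linear (x r)) ->
  F ((a + z) *: x) h = \sum_(j < n.+1) (z / c) ^+ j *:
     Fmx (fun=> bidiag n a (a + z) c) x (single j h) ord0.
Proof.
move=> z0 c0 O1 O2 lx; pose S (r : 'I_d) := bidiag n a (a + z) c.
pose g (i : nat) h := (c / z) ^+ (n - i) *: h.
have bg (i : 'I_n.+1) : bounded_op (g i).
  by rewrite /g -[fun _ => _]/(_ *: idfun); apply: bounded_scale bounded_id.
have hg (r : 'I_d) (i : 'I_n.+1) k : g i (((a + z) *: x) r k) =
    \sum_j S r i j *: x r (g j k).
  rewrite (bidiag_row a (a + z) c i (fun j => x r (g j k))) !scalrfctE /g.
  rewrite !(linZ (lx r)) !scalerA.
  have := ltn_ord i; rewrite ltnS leq_eqVlt => /predU1P[->|lt_in].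
    by rewrite eqxx ltnn subnn expr0 mul1r mulr1 addr0.
  rewrite lt_in ltn_eqF // -scalerDl; congr (_ *: _).
  rewrite subnS -(prednK (n := n - i)) ?subn_gt0 //= exprS.
  by field.
have /(congr1 (fun f => f ord0)) := Fmx_column (ltn0Sn n) O2 O1 bg hg h.
rewrite {1}(sum_single (fun i : 'I_n.+1 => g i h)).
rewrite (lin_sum (Fmx_linear (ltn0Sn n) O2)) fct_sumE /g subn0 => E.
apply: (scalerI (a := (c / z) ^+ n)).
  by rewrite expf_neq0 // mulf_neq0 ?invr_eq0.
rewrite -E scaler_sumr; apply: eq_bigr => j _.
rewrite singleZ (linZ (Fmx_linear (ltn0Sn n) O2)) scalrfctE scalerA.
congr (_ *: _).
have : (j <= n)%N by rewrite -ltnS.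
move: (nat_of_ord j) => i jn.
rewrite -[in RHS](subnK jn) exprD -mulrA -exprMn.
have -> : c / z * (z / c) = 1 by field; rewrite ?c0 z0.
by rewrite expr1n mulr1.
Qed.

(** Padding by a zero last coordinate intertwines the smaller block with the larger, whose entry [b]
    acts on that coordinate only. Hence the Taylor coefficients depend neither on [b] nor on the
    order of expansion. *)
Lemma bidiag_leading n a b c x (j : 'I_n.+1) h :
  Omega (mxtup (fun=> bidiag n a a c) x) ->
  Omega (mxtup (fun=> bidiag n.+1 a b c) x) ->
  (forall r, linear (x r)) ->
  Fmx (fun=> bidiag n.+1 a b c) x (single (widen_ord (leqnSn _) j) h) ord0 =
  Fmx (fun=> bidiag n a a c) x (single j h) ord0.
Proof.
move=> O1 O2 lx.
pose L (v : 'I_n.+1 -> H) (i : 'I_n.+2) := if (i < n.+1)%N then v (inord i) else 0.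
have bL i : bounded_op (fun k => L (Us n.+1 k) i).
  rewrite /L; case: (i < n.+1)%N; last exact: bounded_zero.
  exact: (bounded_coord (direct_sum_unitary (ltn0Sn n))).
have hL (r : 'I_d) v : L (fun i => \sum_j bidiag n a a c i j *: x r (v j)) =
    fun i => \sum_j bidiag n.+1 a b c i j *: x r (L v j).
  apply/funext => i; rewrite /L.
  pose f k := x r (if (k < n.+1)%N then v (inord k) else 0).
  rewrite (bidiag_row a b c i f).
  have fE (k : 'I_n.+1) : x r (v k) = f k.
    by rewrite /f ltn_ord inord_val.
  under eq_bigr do rewrite fE.
  have x0 : x r 0 = 0 := lin0 (lx r).
  case: ifPn => [lt_in|]; last first.
    rewrite -leqNgt => ge_in.
    by rewrite addr0 /f ltnNge ge_in /= x0 scaler0.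
  rewrite (bidiag_row a a c (inord i) f) inordK //.
  rewrite (ltn_eqF lt_in) if_same; congr (_ + _).
  have := lt_in; rewrite ltnS leq_eqVlt => /predU1P[->|lt_in'].
    by rewrite ltnn /f ltnn x0 scaler0.
  by rewrite lt_in'.
have := Fmx_intertwine (ltn0Sn n) (ltn0Sn n.+1) O1 O2 bL hL (single j h).
move=> /(congr1 (fun f => f ord0)); rewrite {1}/L /=.
rewrite (_ : inord 0 = ord0); last by apply/val_inj; rewrite /= inordK.
move=> ->; congr (Fmx _ _ _ ord0); apply/funext => i; rewrite /L /single.
have -> : (i == widen_ord (leqnSn n.+1) j) = (i == j :> nat) by [].
have [lt_in|ge_in] := ltnP i n.+1.
  by have -> : (inord i == j) = (i == j :> nat) by rewrite -val_eqE /= inordK.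
by case: eqP => // e; rewrite e leqNgt ltn_ord in ge_in.
Qed.

(** For c = z = 0 the point is a direct sum of n + 1 >= 2 copies of a x, hence in [Omega]; openness
    covers small [c] and [z]. *)
Lemma bidiag_near n a x : (0 < n)%N -> Omega (a *: x) -> tpow A x ->
  exists e M : R, [/\ 0 < e, 0 <= M & forall c z, cn c <= e -> cn z <= e ->
    Omega (mxtup (fun=> bidiag n a (a + z) c) x) /\
    forall h, hnorm (F (mxtup (fun=> bidiag n a (a + z) c) x) h) <= M * hnorm h].
Proof.
move=> n0 Oax Ax.
have Obase := @nc_domain_dsum _ _ _ _ _ _ _ hOmega n.+1 n0 (fun=> a *: x) (fun=> Oax).
have [e [M [e0 M0 hM]]] := nc_locally_bounded Obase.
have [K1 K1p hK] := tuple_bound Ax.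
(* Each of the n + 1 rows changes by two terms, each at most e/N times [K1] times the norm of
   [h]. *)
pose N : R := n.+1%:R * (2 * K1).
have Np : 0 < N by rewrite !mulr_gt0 ?ltr0n.
exists (e / N), M; split=> // [|c z ce ze]; first exact: divr_gt0.
apply: hM => [|r h]; first by apply: mxtup_tpow => // r; exact: bidiag_upper.
rewrite mxtupE [X in _ - X]/= -(linB (ufin_linear (direct_sum_unitary (ltn0Sn n)))).
apply: le_trans (ufin_norm_le (direct_sum_unitary (ltn0Sn n)) _) _.
apply: le_trans (_ : \sum_(i < n.+1) (2 * K1 * (e / N) * hnorm h) <= _); last first.
  rewrite sumr_const card_ord -[_ *+ n.+1]mulr_natl.
  have -> : n.+1%:R * (2 * K1 * (e / N) * hnorm h) = N * (e / N) * hnorm h.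
    by rewrite {2}/N !mulrA.
  by rewrite [N * _]mulrC divfK // gt_eqF.
apply: ler_sum => i _.
have bx k : hnorm (x r (Us n.+1 h k)) <= K1 * hnorm h.
  apply: le_trans (hK r _) _.
  by rewrite ler_wpM2l ?(ltW K1p) // (ufinV_norm (direct_sum_unitary (ltn0Sn n))).
pose f k := x r (Us n.+1 h (inord k)).
have fE (k : 'I_n.+1) : x r (Us n.+1 h k) = f k by rewrite /f inord_val.
rewrite fctE /dsum; under eq_bigr do rewrite fE.
change ((- (fun j => (a *: x) r (Us n.+1 h j))) i) with (- (a *: x r (Us n.+1 h i))).
rewrite bidiag_row fE.
have -> : forall (P : bool) (u v : H), (if P then a + z else a) *: u + v - a *: u =
    (if P then z else 0) *: u + v.
  move=> P u v; case: P; last by rewrite scale0r add0r addrC addKr.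
  by rewrite scalerDl addrC !addrA addNr add0r.
have t1 (P : bool) k : hnorm ((if P then z else 0) *: f k) <= e / N * (K1 * hnorm h).
  rewrite hnormZ; apply: ler_pM; rewrite ?normc_ge0 ?hnorm_ge0 //.
    by case: P; rewrite // Normc.normc0 divr_ge0 // ltW.
  exact: bx.
have t2 (P : bool) k : hnorm (if P then c *: f k else 0) <= e / N * (K1 * hnorm h).
  case: P; last by rewrite hnorm0 !mulr_ge0 ?invr_ge0 ?hnorm_ge0 ?ltW.
  by rewrite hnormZ; apply: ler_pM; rewrite ?normc_ge0 ?hnorm_ge0 //; exact: bx.
apply: le_trans (hnorm_triangle _ _) _; apply: le_trans (lerD (t1 _ _) (t2 _ _)) _.
by rewrite le_eqVlt; apply/orP; left; apply/eqP; ring.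
Qed.

Lemma omega_near a x : Omega (a *: x) -> tpow A x ->
  exists e M : R, [/\ 0 < e, 0 <= M & forall z, cn z <= e ->
    Omega ((a + z) *: x) /\ forall h, hnorm (F ((a + z) *: x) h) <= M * hnorm h].
Proof.
move=> Oax Ax; have [e [M [e0 M0 hM]]] := nc_locally_bounded Oax.
have [K1 K1p hK] := tuple_bound Ax.
exists (e / K1), M; split=> // [|z ze]; first exact: divr_gt0.
apply: hM => [|r h]; first exact: tpow_scale.
change (hnorm ((a + z) *: x r h - a *: x r h) <= e * hnorm h).
rewrite scalerDl addrC addKr hnormZ.
apply: le_trans (_ : e / K1 * (K1 * hnorm h) <= _); last by rewrite mulrA divfK // gt_eqF.
by apply: ler_pM; rewrite ?normc_ge0 ?hnorm_ge0.
Qed.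

(** The first coordinate axis is invariant under the upper triangular block, which acts there as
    [a]; this identifies the zeroth Taylor coefficient. *)
Lemma Fmx_bidiag_first n a c x h : Omega (a *: x) ->
  Omega (mxtup (fun=> bidiag n a a c) x) -> (forall r, linear (x r)) ->
  Fmx (fun=> bidiag n a a c) x (single ord0 h) = single ord0 (F (a *: x) h).
Proof.
move=> O1 O2 lx.
have bG (i : 'I_n.+1) : bounded_op (fun k => single ord0 k i) by exact: bounded_single.
apply: (Fmx_column (ltn0Sn n) O2 O1 bG) => r i k.
pose f m := x r (if m == 0%N then k else 0).
rewrite (eq_bigr (fun j : 'I_n.+1 => bidiag n a a c i j *: f j)) => [|j _]; last by [].
rewrite bidiag_row if_same /single -val_eqE /f /= (lin0 (lx r)) scaler0 if_same addr0.
by case: eqP => // _; rewrite (lin0 (lx r)) scaler0.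
Qed.

(** This is [bidiag_eigen] for n = 3: by [bidiag_leading] the first three coefficients do not depend
    on [z], and the last term carries (z/e)^3 and is controlled by the local bound of [F]. *)
Lemma expandable_nc a x h : tpow A x -> Omega (a *: x) ->
  expandable (fun b => F (b *: x) h) a.
Proof.
move=> Ax Oax.
have lx r : linear (x r) := bounded_lin (subalg_bounded hA (Ax r)).
have [e1 [M1 [e10 M10 h1]]] := omega_near Oax Ax.
have [e2 [M2 [e20 M20 h2]]] := bidiag_near (isT : (0 < 2)%N) Oax Ax.
have [e3 [M3 [e30 M30 h3]]] := bidiag_near (isT : (0 < 3)%N) Oax Ax.
pose e := Num.min e1 (Num.min e2 e3).
have ep : 0 < e by rewrite !lt_min e10 e20.
have ec : cn e%:C = e by rewrite normcR gtr0_norm.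
have c0 : e%:C != 0 by rewrite -normc_gt0 ec.
have [ee1 ee2 ee3] : [/\ e <= e1, e <= e2 & e <= e3].
  by rewrite !ge_min !lexx !orbT.
have O2 : Omega (mxtup (fun=> bidiag 2 a a e%:C) x).
  by have [] := h2 e%:C 0; rewrite ?addr0 ?ec // Normc.normc0 ltW.
pose u (j : 'I_3) := Fmx (fun=> bidiag 2 a a e%:C) x (single j h) ord0.
exists ((e%:C)^-1 *: u (inord 1)), ((e%:C)^-1 ^+ 2 *: u (inord 2)).
exists (M3 * hnorm h / e ^+ 3), e; split=> // [|z ze].
  by rewrite !mulr_ge0 ?hnorm_ge0 // invr_ge0 exprn_ge0 // ltW.
(* The intertwining column contains c/z, so z = 0 is treated apart. *)
have [->|z0] := eqVneq z 0.
  rewrite addr0 scale0r expr0n /= scale0r !addr0 subrr hnorm0.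
  by rewrite !mulr_ge0 ?hnorm_ge0 ?exprn_ge0 ?normc_ge0 // invr_ge0 exprn_ge0 // ltW.
have [Oz _] := h1 z (le_trans ze ee1).
have [|Ob hb] := h3 e%:C z _ (le_trans ze ee3); first by rewrite ec.
rewrite (bidiag_eigen h z0 c0 Oz Ob lx) big_ord_recr /=.
rewrite (eq_bigr (fun j : 'I_3 => (z / e%:C) ^+ j *: u j)); last first.
  by move=> j _; rewrite (bidiag_leading j h O2 Ob lx).
rewrite 3!big_ord_recl big_ord0 /= expr0 scale1r addr0 expr1.
have -> : u ord0 = F (a *: x) h by rewrite /u Fmx_bidiag_first.
have -> : lift ord0 ord0 = inord 1 :> 'I_3 by apply/val_inj; rewrite /= inordK.
have -> : lift ord0 (lift ord0 ord0) = inord 2 :> 'I_3.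
  by apply/val_inj; rewrite /= inordK.
rewrite !scalerA -exprMn !addrA addrC.
rewrite -[bump 0 (bump 0 0)]/2%N addrK hnormZ normcX Normc.normcM Normc.normcV ec.
have -> : M3 * hnorm h / e ^+ 3 * cn z ^+ 3 = (cn z / e) ^+ 3 * (M3 * hnorm h).
  by rewrite expr_div_n; ring.
rewrite ler_wpM2l ?exprn_ge0 ?divr_ge0 ?normc_ge0 ?(ltW ep) //.
exact: Fmx_single_bound.
Qed.

(** * Expansion at the origin *)

Fixpoint wordop y (w : seq 'I_d) : H -> H :=
  if w is r :: w' then y r \o wordop y w' else idfun.

Lemma bounded_wordop y w : tpow A y -> bounded_op (wordop y w).
Proof.
move=> Ay; elim: w => [|r w ih]; first exact: bounded_id.
exact: (bounded_comp (subalg_bounded hA (Ay r)) ih).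
Qed.

Definition short_words (m : nat) : seq (seq 'I_d) :=
  sort (fun v w => (size w <= size v)%N) [seq val w | w <- enum {: m.-bseq 'I_d}].

Lemma mem_short_words m w : (w \in short_words m) = (size w <= m)%N.
Proof.
rewrite mem_sort; apply/mapP/idP => [[w' _ ->]|wm]; first exact: size_bseq.
by exists (Bseq wm); rewrite ?mem_enum.
Qed.

Lemma uniq_short_words m : uniq (short_words m).
Proof. by rewrite sort_uniq map_inj_uniq ?enum_uniq //; exact: val_inj. Qed.

Definition word m (p : 'I_(size (short_words m))) : seq 'I_d :=
  nth [::] (short_words m) p.

Lemma size_word m (p q : 'I_(size (short_words m))) :
  (p < q)%N -> (size (word q) <= size (word p))%N.
Proof.
move=> pq; apply: (@sorted_ltn_nth _ (fun v w => (size w <= size v)%N)) => //.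
- by move=> a b c ab bc; exact: leq_trans bc ab.
- by apply: sort_sorted => a b; exact: leq_total.
- by rewrite inE.
- by rewrite inE.
Qed.

Lemma word_inj m : injective (@word m).
Proof.
move=> p q /eqP; rewrite nth_uniq ?uniq_short_words // => /eqP pq.
exact: val_inj.
Qed.

Lemma word_surj m w : (size w <= m)%N -> exists p, @word m p = w.
Proof.
rewrite -mem_short_words => hw; have := hw; rewrite -index_mem => hi.
by exists (Ordinal hi); rewrite /word /= nth_index.
Qed.

(* Creation by the letter [r] on the words of length at most [m], listed by
   decreasing length so that the matrices are upper triangular. *)
Definition creation m a (r : 'I_d) : 'M[R[i]]_(size (short_words m)) :=
  \matrix_(p, q) if word p == r :: word q then a else 0.

Lemma creation_omega m : Omega 0 -> (0 < size (short_words m))%N ->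
  exists2 s : R, 0 < s & Omega (mxtup (creation m s%:C) (fun=> idfun)).
Proof.
move=> O0 D0; set D := size _ in D0.
have [e [M [e0 M0 hM]]] := nc_locally_bounded O0.
(* All D^2 matrix entries contribute, each at most e/N; this keeps the point close to 0. *)
pose N : R := D%:R * D%:R.
have Np : 0 < N by rewrite mulr_gt0 ?ltr0n.
exists (e / N); first exact: divr_gt0.
apply: (proj1 (hM _ _ _)) => [|r h].
  apply: mxtup_tpow => //; last by move=> ?; exact: (subalg_one hA).
  move=> r i j ji; rewrite mxE; case: eqP => // wij.
  by have := size_word ji; rewrite wij ltnn.
change (hnorm (mxtup (creation m (e / N)%:C) (fun=> idfun) r h - 0) <= e * hnorm h).
rewrite subr0 mxtupE; apply: le_trans (ufin_norm_le (direct_sum_unitary D0) _) _.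
apply: le_trans (_ : \sum_(i < D) \sum_(j < D) (e / N * hnorm h) <= _).
  apply: ler_sum => i _; apply: le_trans (hnorm_sum _ _ _) _.
  apply: ler_sum => j _; rewrite hnormZ; apply: ler_pM; rewrite ?normc_ge0 ?hnorm_ge0 //.
    rewrite mxE; case: eqP => _; last by rewrite Normc.normc0 divr_ge0 // ltW.
    by rewrite normcR ger0_norm // divr_ge0 // ltW.
  exact: (ufinV_norm (direct_sum_unitary D0)).
rewrite !sumr_const !card_ord -mulrnA -[_ *+ _]mulr_natl natrM -/N.
by rewrite mulrA [N * _]mulrC divfK // gt_eqF.
Qed.

(** [F] at the creation point does not involve [x], and evaluating words at [t *: x] carries it to
    the bidiagonal point. So the coefficient is a homogeneous polynomial of degree [j] in [x], fixed
    before [x] and [b] are given. *)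
Lemma bidiag_zero_words n (j : 'I_n.+1) c h : (j < n)%N -> Omega 0 ->
  exists (t : R[i]) (l : seq (seq 'I_d * H)), forall x b, tpow A x ->
    Omega (mxtup (fun=> bidiag n 0 b c) x) ->
    Fmx (fun=> bidiag n 0 b c) x (single j h) ord0 =
    \sum_(p <- l) wordop (t *: x) p.1 p.2.
Proof.
move=> jn O0.
have [root rootE] := @word_surj j [::] isT.
have D0 : (0 < size (short_words j))%N by apply: leq_ltn_trans (ltn_ord root).
have [s s0 Os] := creation_omega O0 D0.
set D := size _ in root rootE D0 Os.
have sn0 : s%:C != 0 :> R[i] by rewrite -normc_gt0 normcR normr_gt0 gt_eqF.
pose S := creation j s%:C.
pose u := Fmx S (fun=> idfun) (single root h).
(* The ratio c/s turns creation with weight [s] into a shift with weight [c]; only words of length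
   [j] land in row 0. *)
exists (c / s%:C), [seq (word p, u p) | p <- enum 'I_D & size (word p) == j].
move=> x b Ax Ob; set t := c / _.
have lx r : linear (x r) := bounded_lin (subalg_bounded hA (Ax r)).
have Atx : tpow A (t *: x) by exact: tpow_scale.
have lW w : linear (wordop (t *: x) w) := bounded_lin (bounded_wordop w Atx).
(* [L] evaluates the word [w] at [t *: x] and puts the result in the coordinate
   [j - size w], so a creation by [r] becomes [x r] followed by a shift. *)
pose L (v : 'I_D -> H) (i : nat) :=
  \sum_(p < D | (size (word p) + i == j)%N) wordop (t *: x) (word p) (v p).
have bL (i : 'I_n.+1) : bounded_op (fun k => L (Us D k) i).
  apply: bounded_sum => p.
  exact: (bounded_comp (bounded_wordop _ Atx) (bounded_coord (direct_sum_unitary D0) p)).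
have Lbig v i : (j < i)%N -> L v i = 0.
  move=> ji; rewrite /L big_pred0 // => p; apply/eqP => e.
  by have := leq_addl (size (word p)) i; rewrite e leqNgt ji.
have hL r (v : 'I_D -> H) : (fun i : 'I_n.+1 => L (fun p => \sum_q S r p q *: (v q)) i) =
    fun i => \sum_(k < n.+1) bidiag n 0 b c i k *: x r (L v k).
  apply/funext => i; rewrite (bidiag_row 0 b c i (fun k => x r (L v k))).
  (* As j < n, [L] vanishes in the last row, so the entry [b] never enters. *)
  have -> : (if i == n :> nat then b else 0) *: x r (L v i) = 0.
    case: eqP => [->|_]; last by rewrite scale0r.
    by rewrite Lbig // (lin0 (lx r)) scaler0.
  have -> : (if (i < n)%N then c *: x r (L v i.+1) else 0) = c *: x r (L v i.+1).
    case: ltnP => // ni; rewrite Lbig ?(lin0 (lx r)) ?scaler0 //.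
    by rewrite ltnS (leq_trans _ ni) // ltnW.
  rewrite add0r /L (lin_sum (lx r)) scaler_sumr.
  under eq_bigr do rewrite (lin_sum (lW _)).
  rewrite exchange_big /= [RHS]big_mkcond; apply: eq_bigr => q _.
  case: ifP => [/eqP qij|qij].
    (* Column [q] has a single nonzero entry, in the row of [r :: word q]; the length condition
       leaves room for that word. *)
    have [|p pE] := @word_surj j (r :: word q).
      by have := leq_addr i (size (word q)).+1; rewrite addSnnS qij.
    rewrite (bigD1 p) /=; last by rewrite pE /= addSnnS qij.
    rewrite big1 => [|p' /andP[_ pp']]; last first.
      rewrite mxE -pE (inj_eq (@word_inj _)) (negPf pp') scale0r.
      exact: (lin0 (lW _)).
    rewrite addr0 mxE pE eqxx (linZ (lW _)) /=.
    change (s%:C *: (t *: x r (wordop (t *: x) (word q) (v q))) =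
      c *: x r (wordop (t *: x) (word q) (v q))).
    by rewrite scalerA mulrC divfK.
  rewrite big1 // => p pij; rewrite mxE; case: eqP => [pE|_].
    by move: pij; rewrite pE /= addSnnS qij.
  by rewrite scale0r (lin0 (lW _)).
have := Fmx_intertwine D0 (ltn0Sn n) Os Ob bL hL (single root h).
move=> /(congr1 (fun f => f ord0)).
have -> : (fun i : 'I_n.+1 => L (single root h) i) = single j h.
  apply/funext => i; rewrite /L /single.
  have [->|ij] := eqVneq i j.
    rewrite (bigD1 root) /= ?rootE //= eqxx big1 ?addr0 // => p /andP[_ /negPf ->].
    exact: (lin0 (lW _)).
  rewrite big1 // => p pij; case: eqP => [pr|_]; last exact: (lin0 (lW _)).
  by move: pij ij; rewrite pr rootE /= add0n val_eqE => ->.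
move=> <-; rewrite /L big_map big_filter big_enum_cond /=.
by apply: eq_bigl => p; rewrite addn0.
Qed.

(** Diagonal part and shift are estimated separately by sums of squares, so no factor [n] appears,
    unlike in [bidiag_near]. *)
Lemma bidiag_zero_bound n b c x (K : R) r h : 0 <= K ->
  (forall h, hnorm (x r h) <= K * hnorm h) ->
  hnorm (mxtup (fun=> bidiag n 0 b c) x r h) <= (cn b + cn c) * K * hnorm h.
Proof.
move=> K0 hK; have hn := direct_sum_unitary (ltn0Sn n).
pose f k := x r (Us n.+1 h (inord k)).
have fE (k : 'I_n.+1) : x r (Us n.+1 h k) = f k by rewrite /f inord_val.
have hf k : hnorm (f k) <= K * hnorm (Us n.+1 h (inord k)) by exact: hK.
have sumsq : \sum_(k < n.+1) hnorm (Us n.+1 h (inord k)) ^+ 2 = hnorm h ^+ 2.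
  rewrite -{2}(ufinVK hn h) (ufin_norm hn); apply: eq_bigr => k _.
  by rewrite inord_val.
have bound a (g : 'I_n.+1 -> H) (v : nat -> R) :
    (forall i, 0 <= v i) -> \sum_(i < n.+1) v i ^+ 2 <= hnorm h ^+ 2 ->
    (forall i, hnorm (g i) <= cn a * (K * v i)) ->
    hnorm (U n.+1 g) <= cn a * K * hnorm h.
  move=> v0 hv hg; have aK : 0 <= cn a * K by rewrite mulr_ge0 ?normc_ge0.
  rewrite -(@ler_pXn2r _ 2) ?nnegrE ?hnorm_ge0 ?mulr_ge0 ?hnorm_ge0 ?normc_ge0 //.
  rewrite (ufin_norm hn) exprMn; apply: le_trans (ler_wpM2l (sqr_ge0 _) hv).
  rewrite mulr_sumr; apply: ler_sum => i _; rewrite -exprMn.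
  by rewrite ler_pXn2r ?nnegrE ?hnorm_ge0 ?mulr_ge0 ?normc_ge0 // -mulrA.
have -> : mxtup (fun=> bidiag n 0 b c) x r h =
   U n.+1 (fun i => (if i == n :> nat then b else 0) *: f i) +
   U n.+1 (fun i => if (i < n)%N then c *: f i.+1 else 0).
  rewrite mxtupE -(linD (ufin_linear hn)); congr (U _); apply/funext => i.
  by under eq_bigr do rewrite fE; rewrite bidiag_row.
apply: le_trans (hnorm_triangle _ _) _; rewrite !mulrDl; apply: lerD.
  apply: (bound b _ (fun k => hnorm (Us n.+1 h (inord k)))) => [i||i].
  - exact: hnorm_ge0.
  - by rewrite sumsq.
  - case: ifP => _; first by rewrite hnormZ ler_wpM2l ?normc_ge0.
    by rewrite scale0r hnorm0 !mulr_ge0 ?normc_ge0 ?hnorm_ge0.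
(* The shift drops the first coordinate and is extended by 0 in the last row. *)
pose v k := if (k < n)%N then hnorm (Us n.+1 h (inord k.+1)) else 0.
apply: (bound c _ v) => [i||i].
- by rewrite /v; case: ifP => // _; exact: hnorm_ge0.
- rewrite -sumsq big_ord_recr /= {2}/v ltnn expr0n /= addr0.
  rewrite [leRHS]big_ord_recl; rewrite ler_wpDl ?sqr_ge0 //.
  by apply: ler_sum => k _; rewrite /v ltn_ord.
- rewrite /v; case: ifP => _; first by rewrite hnormZ ler_wpM2l ?normc_ge0.
  by rewrite hnorm0 !mulr0.
Qed.

(** Because [bidiag_zero_bound] is uniform in [n], one radius [c] serves every order. The
    polynomials are chosen before [x], so they are common to all points with the bound [K]. *)
Lemma nc_zero_expansion (K : R) : 0 < K -> Omega 0 ->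
  exists c M : R, [/\ 0 < c, 0 <= M & forall n h,
  exists (t : 'I_n -> R[i]) (l : 'I_n -> seq (seq 'I_d * H)),
  forall x b, tpow A x -> (forall r h, hnorm (x r h) <= K * hnorm h) ->
    b != 0 -> cn b <= c -> Omega (b *: x) ->
    hnorm (F (b *: x) h - \sum_(j < n) (b / c%:C) ^+ j *:
      \sum_(p <- l j) wordop (t j *: x) p.1 p.2) <= M * (cn b / c) ^+ n * hnorm h].
Proof.
move=> K0 O0; have [e [M [e0 M0 hM]]] := nc_locally_bounded O0.
(* Gives (|b| + c) K <= e whenever |b| <= c. *)
pose c := e / (2 * K); have c0 : 0 < c by rewrite divr_gt0 // mulr_gt0.
exists c, M; split=> // n h.
have cc0 : c%:C != 0 :> R[i] by rewrite -normc_gt0 normcR normr_gt0 gt_eqF.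
have /choice[t /choice[l hl]] := fun j : 'I_n =>
  bidiag_zero_words (j := widen_ord (leqnSn n) j) c%:C h (ltn_ord j) O0.
exists t, l => x b Ax hK b0 bc Obx.
have lx r : linear (x r) := bounded_lin (subalg_bounded hA (Ax r)).
have [Ob hb] : Omega (mxtup (fun=> bidiag n 0 b c%:C) x) /\
    forall h, hnorm (F (mxtup (fun=> bidiag n 0 b c%:C) x) h) <= M * hnorm h.
  apply: hM => [|r k]; first by apply: mxtup_tpow => // r; exact: bidiag_upper.
  rewrite [X in _ - X]/(0 : H) subr0.
  apply: le_trans (bidiag_zero_bound _ _ _ _ (ltW K0) (hK r)) _.
  rewrite ler_wpM2r ?hnorm_ge0 // normcR gtr0_norm //.
  apply: le_trans (_ : (c + c) * K <= _); first by rewrite ler_wpM2r ?(ltW K0) ?lerD2r.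
  by rewrite le_eqVlt /c; apply/orP; left; apply/eqP; field; rewrite gt_eqF.
have := @bidiag_eigen n 0 b c%:C x h b0 cc0.
rewrite add0r => /(_ Obx Ob lx) ->; rewrite big_ord_recr /=.
under eq_bigr do rewrite (hl _ _ _ Ax Ob).
rewrite addrC addrK hnormZ normcX Normc.normcM Normc.normcV normcR gtr0_norm //.
have cb : 0 <= cn b / c by apply: divr_ge0; [exact: normc_ge0|exact: ltW].
rewrite -mulrA mulrCA ler_wpM2l ?exprn_ge0 //.
exact: Fmx_single_bound.
Qed.

(** * Strong operator convergence near the origin *)

Lemma wordop_cvg (K : R) (x_ : nat -> tup) x w h : 0 <= K ->
  (forall j, tpow A (x_ j)) ->
  (forall j r h, hnorm (x_ j r h) <= K * hnorm h) -> sot_cvg_tuple x_ x ->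
  (fun j => wordop (x_ j) w h) @ \oo --> wordop x w h.
Proof.
move=> K0 Ax hK hx; elim: w => [|r w ih] /=; first exact: cvg_cst.
apply/cvg_hnormP => e e0; pose K1 := K + 1.
have K1p : 0 < K1 by rewrite /K1; lra.
have e2 : 0 < e / 2 by rewrite divr_gt0.
have [N1 hN1] := (cvg_hnormP _ _).1 ih (e / 2 / K1) (divr_gt0 e2 K1p).
have [N2 hN2] := (cvg_hnormP _ _).1 (hx r (wordop x w h)) (e / 2) e2.
exists (maxn N1 N2) => j; rewrite geq_max => /andP[j1 j2].
have lx : linear (x_ j r) := bounded_lin (subalg_bounded hA (Ax j r)).
(* The first difference is controlled by the uniform bound [K], the second converges at a fixed
   vector. *)
have -> : x_ j r (wordop (x_ j) w h) - x r (wordop x w h) =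
    x_ j r (wordop (x_ j) w h - wordop x w h) +
    (x_ j r (wordop x w h) - x r (wordop x w h)).
  by rewrite (linB lx) addrA addrNK.
apply: le_trans (hnorm_triangle _ _) _; rewrite (splitr e); apply: lerD; last exact: hN2.
apply: le_trans (hK _ _ _) _; apply: le_trans (ler_wpM2l K0 (hN1 j j1)) _.
rewrite mulrA ler_pdivrMr // mulrC ler_wpM2l ?divr_ge0 ?(ltW e0) // /K1; lra.
Qed.

Lemma sot_cvg_scale a (x_ : nat -> tup) x :
  sot_cvg_tuple x_ x -> sot_cvg_tuple (fun j => a *: x_ j) (a *: x).
Proof. by move=> hx r h; exact: (cvgZr (hx r h)). Qed.

(** Remainders are small uniformly in [j] and in [b] on the circle, and the finitely many remaining
    polynomials converge strongly. The radius is chosen before [h] and [e], as the three circles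
    argument needs. *)
Lemma nc_zero_cvg (K : R) (x_ : nat -> tup) x : 0 < K -> Omega 0 ->
  (forall j, tpow A (x_ j)) -> tpow A x ->
  (forall j r h, hnorm (x_ j r h) <= K * hnorm h) ->
  (forall r h, hnorm (x r h) <= K * hnorm h) ->
  (forall j b, cn b <= 1 -> Omega (b *: x_ j)) ->
  (forall b, cn b <= 1 -> Omega (b *: x)) ->
  sot_cvg_tuple x_ x ->
  exists r : R, [/\ 0 < r, r <= 1 & forall h e, 0 < e -> exists N,
    forall j b, (N <= j)%N -> cn b = r ->
      hnorm (F (b *: x_ j) h - F (b *: x) h) <= e].
Proof.
move=> K0 O0 Ax_ Ax hK_ hK Ox_ Ox hx.
have [c [M [c0 M0 hM]]] := nc_zero_expansion K0 O0.
(* c/2 makes the remainder geometric with ratio 1/2; the cap 1 keeps the scaled points in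
   [Omega]. *)
pose r := Num.min (c / 2) 1.
have r0 : 0 < r by rewrite lt_min divr_gt0 //=.
have r1 : r <= 1 by rewrite ge_min lexx orbT.
have rc : r / c <= 2^-1.
  by rewrite ler_pdivrMr // mulrC ge_min lexx.
exists r; split=> // h e e0.
have [n hn] : exists n : nat, M * 2^-1 ^+ n * hnorm h <= e / 3.
  pose q := M * hnorm h; have q0 : 0 <= q by rewrite mulr_ge0 ?hnorm_ge0.
  pose n := Num.bound (3 * q / e).
  exists n; rewrite mulrAC -/q ler_pdivlMr // exprVn.
  have := archi_boundP (divr_ge0 (mulr_ge0 (ler0n R 3) q0) (ltW e0)).
  rewrite -/n ltr_pdivrMr // => hq.
  rewrite mulrAC ler_pdivrMr ?exprn_gt0 // mulrC [e * _]mulrC.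
  apply: le_trans (ltW hq) _; rewrite ler_wpM2r ?(ltW e0) //.
  by rewrite -natrX ler_nat ltnW // ltn_expl.
have [t [l htl]] := hM n h.
pose Q (y : tup) (j : 'I_n) := \sum_(p <- l j) wordop (t j *: y) p.1 p.2.
have hQ j : (fun i => Q (x_ i) j) @ \oo --> Q x j.
  rewrite /Q; elim: (l j) => [|p s ih].
    by rewrite big_nil; under eq_fun do rewrite big_nil; exact: cvg_cst.
  rewrite big_cons; under eq_fun do rewrite big_cons.
  apply: cvgD => //; apply: (@wordop_cvg (cn (t j) * K)) => //.
  - by rewrite mulr_ge0 ?normc_ge0 // ltW.
  - by move=> i; exact: tpow_scale.
  - move=> i r' k; change (hnorm (t j *: x_ i r' k) <= cn (t j) * K * hnorm k).
    by rewrite hnormZ -mulrA ler_wpM2l ?normc_ge0.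
  - exact: sot_cvg_scale.
(* There are [n] coefficients; dividing by n + 1 also covers n = 0. *)
have e'0 : 0 < e / 3 / n.+1%:R by rewrite !divr_gt0.
have /choice[N hN] := fun j => (cvg_hnormP _ _).1 (hQ j) _ e'0.
exists (\max_j N j)%N => i b Ni br.
have b0 : b != 0 by rewrite -normc_gt0 br.
have bc : cn b <= c.
  by rewrite br; apply: le_trans (_ : c / 2 <= _); [rewrite ge_min lexx|lra].
have b1 : cn b <= 1 by rewrite br.
have E1 := htl _ _ (Ax_ i) (hK_ i) b0 bc (Ox_ i b b1).
have E2 := htl _ _ Ax hK b0 bc (Ox b b1).
have small : M * (cn b / c) ^+ n * hnorm h <= e / 3.
  apply: le_trans hn; rewrite ler_wpM2r ?hnorm_ge0 // ler_wpM2l //.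
  by rewrite lerXn2r ?nnegrE ?br ?divr_ge0 ?(ltW r0) ?(ltW c0) ?invr_ge0.
have E3 : hnorm (\sum_(j < n) (b / c%:C) ^+ j *: Q (x_ i) j -
    \sum_(j < n) (b / c%:C) ^+ j *: Q x j) <= e / 3.
  rewrite -sumrB; apply: le_trans (hnorm_sum _ _ _) _.
  apply: le_trans (_ : \sum_(j < n) (e / 3 / n.+1%:R) <= _).
    apply: ler_sum => j _; rewrite -scalerBr hnormZ normcX Normc.normcM Normc.normcV.
    rewrite normcR gtr0_norm //.
    apply: le_trans (_ : 1 * (e / 3 / n.+1%:R) <= _); last by rewrite mul1r.
    apply: ler_pM; rewrite ?exprn_ge0 ?hnorm_ge0 ?divr_ge0 ?normc_ge0 ?(ltW c0) //.
      by rewrite exprn_ile1 ?divr_ge0 ?normc_ge0 ?(ltW c0) // ler_pdivrMr // mul1r.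
    by apply: hN; apply: leq_trans Ni; exact: leq_bigmax.
  rewrite sumr_const card_ord -[_ *+ n]mulr_natl mulrA ler_pdivrMr //.
  by rewrite mulrC ler_wpM2l ?divr_ge0 ?(ltW e0) // ler_nat.
set S1 := \sum_(j < n) _ in E3; set S2 := \sum_(j < n) _ in E3.
have -> : F (b *: x_ i) h - F (b *: x) h = (F (b *: x_ i) h - S1) + (S1 - S2) -
    (F (b *: x) h - S2).
  by rewrite opprB !addrA addrNK addrNK.
apply: le_trans (hnorm_triangleB _ _) _.
apply: le_trans (lerD (hnorm_triangle _ _) (lexx _)) _.
by move: (le_trans E1 small) (le_trans E2 small); rewrite -/S1 -/S2; lra.
Qed.

End MatrixPoints.

(** * Countable direct sums *)

Section CountableUnitary.
Context {R : realType} {H : hilbertType R}.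
Context {V : H -> nat -> H} {Vi : (nat -> H) -> H}.
Context (hV : unitary_to_oo V Vi).
Implicit Types (h k : H) (j : nat).

Definition delta j h : nat -> H := fun i => if i == j then h else 0.

Lemma series_delta (Z : zmodType) (f : nat -> Z) j n :
  (forall i, i != j -> f i = 0) -> (j < n)%N -> series f n = f j.
Proof.
move=> f0 jn; rewrite /series /= big_mkord (bigD1 (Ordinal jn)) //=.
by rewrite big1 ?addr0 // => i ij; apply: f0.
Qed.

Lemma delta_ell2 j h : ell2 (delta j h).
Proof.
apply: (@is_cvg_near_cst _ _ (hnorm h ^+ 2)); exists j.+1 => // n /= jn.
rewrite (@series_delta _ _ j) //; first by rewrite /delta eqxx.
by move=> i /negPf ij; rewrite /delta ij hnorm0 expr0n.
Qed.

Lemma inner_oo_delta (u : nat -> H) j h : inner_oo u (delta j h) = inner (u j) h.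
Proof.
apply: (@lim_near_cst R[i]^o); first exact: norm_hausdorff.
exists j.+1 => // n /= jn; rewrite (@series_delta _ _ j) //.
  by rewrite /delta eqxx.
by move=> i /negPf ij; rewrite /delta ij linear0r.
Qed.

Lemma coord_inject j h : V (Vi (delta j h)) = delta j h.
Proof. by apply: (unitaryK hV); exact: delta_ell2. Qed.

Lemma inject_norm j h : hnorm (Vi (delta j h)) = hnorm h.
Proof.
apply/eqP; rewrite -(@eqrXn2 _ 2) ?hnorm_ge0 //; apply/eqP; apply: complexI.
rewrite -!inner_hnorm -(unitary_adjoint hV) //; last exact: delta_ell2.
by rewrite inner_oo_delta coord_inject /delta eqxx.
Qed.

Lemma coord_linear : linear V.
Proof. by move=> a h k; apply: (unitary_linear hV). Qed.

Lemma bounded_inject j : bounded_op (fun h => Vi (delta j h)).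
Proof.
split=> [a h k|]; last by exists 1 => h; rewrite mul1r inject_norm.
rewrite -[RHS](unitary_adjK hV) // coord_linear !coord_inject; congr Vi.
apply/funext => i.
change ((if i == j then a *: h + k else 0) =
  a *: (if i == j then h else 0) + (if i == j then k else 0)).
by case: eqP => _ //; rewrite scaler0 addr0.
Qed.

(** Bessel's inequality: [q] is the projection of [h] to the summand [j], and |h - q|^2 = |h|^2 -
    |y|^2 is nonnegative. *)
Lemma coord_norm_le j h : hnorm (V h j) <= hnorm h.
Proof.
set y := V h j; set q := Vi (delta j y).
have hq : inner h q = (hnorm y ^+ 2)%:C.
  by rewrite -(unitary_adjoint hV) // ?inner_oo_delta ?inner_hnorm //; exact: delta_ell2.
have : hnorm (h - q) ^+ 2 = hnorm h ^+ 2 - hnorm y ^+ 2.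
  apply: complexI; rewrite rmorphB /= -inner_hnorm linearBl !linearDr !linearNr /=.
  have hq' : inner q h = (hnorm y ^+ 2)%:C.
    have -> : inner q h = (-1) ^+ false * Num.conj (inner h q) := hermC _ q h.
    rewrite hq expr0 mul1r; apply/eqP.
    by rewrite -CrealE; apply/complex_realP; exists (hnorm y ^+ 2).
  rewrite hq hq' !inner_hnorm inject_norm; ring.
move=> e; rewrite -(@ler_pXn2r _ 2) ?nnegrE ?hnorm_ge0 // -subr_ge0 -e.
exact: sqr_ge0.
Qed.

Lemma bounded_coord_oo j : bounded_op (fun h => V h j).
Proof.
split=> [a h k|]; first by rewrite coord_linear.
by exists 1 => h; rewrite mul1r coord_norm_le.
Qed.

Lemma dsum_inject (T : nat -> H -> H) j h : (forall i, T i 0 = 0) ->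
  Vi (dsum T (V (Vi (delta j h)))) = Vi (delta j (T j h)).
Proof.
move=> T0; rewrite coord_inject; congr Vi; apply/funext => i.
by rewrite /dsum /delta; case: eqP => [->|].
Qed.

End CountableUnitary.

(** * Extension beyond the unit disc and conclusion *)

Lemma bernoulli (R : realType) (e : R) n : 0 <= e -> 1 + n%:R * e <= (1 + e) ^+ n.
Proof.
move=> e0; elim: n => [|n ih]; first by rewrite mul0r addr0 expr0.
rewrite exprS -nat1r; apply: le_trans (ler_wpM2l _ ih); last by rewrite addr_ge0.
have : 0 <= n%:R * (e * e) by rewrite !mulr_ge0.
nra.
Qed.

Theorem theorem6p3 (R : realType) (H : hilbertType R)
  (hH : infinite_dimensional H)
  (A : set (H -> H)) (hA : unital_closed_subalgebra A)
  (U : forall n : nat, ('I_n -> H) -> H)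
  (Us : forall n : nat, H -> ('I_n -> H))
  (hU : direct_sum_property A U Us)
  (d : nat) (hd : (0 < d)%N)
  (Omega : set ('I_d -> (H -> H)))
  (hOmega : nc_domain A U Us Omega) (hbal : balanced Omega)
  (E : nat -> set ('I_d -> (H -> H))) (hE : exhaustion A Omega E)
  (F : ('I_d -> (H -> H)) -> (H -> H))
  (hF : nc_function Omega F) (hFE : forall k : nat, bounded_on F (E k))
  (k : nat) (x_ : nat -> 'I_d -> (H -> H)) (x : 'I_d -> (H -> H))
  (hx_ : forall j : nat, E k (x_ j)) (hx : E k x)
  (hcvg : sot_cvg_tuple x_ x) :
  sot_cvg (fun j : nat => F (x_ j)) (F x).
Proof.
have EO y : E k y -> Omega y by rewrite (exhaustion_cover hE) => ?; exists k.
have OA y : Omega y -> tpow A y := @nc_domain_sub _ _ _ _ _ _ _ hOmega y.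
have scale_omega b y : cn b <= 1 -> Omega y -> Omega (b *: y).
  by move=> b1; apply: hbal; rewrite normcE lecR.
have O0 : Omega 0.
  have := scale_omega 0 x; rewrite scale0r Normc.normc0; apply=> //.
  exact: EO.
(* The limit takes index 0 and [x_ j] index j + 1, so one direct sum [X] contains them all. *)
pose y j := if j is j'.+1 then x_ j' else x.
have Ey j : E k (y j) by case: j.
have [V [Vi [hV EX]]] := exhaustion_dsum hE Ey.
set X := fun r => _ in EX.
have lin_y j r : linear (y j r).
  exact: (bounded_lin (omega_bounded hA hOmega _ (EO _ (Ey j)))).
have interX j r h : X r (Vi (delta j h)) = Vi (delta j (y j r h)).
  by rewrite /X /=; apply: (dsum_inject hV (T := fun j => y j r)) => i; exact: lin0.
have OX := EO _ EX; have AX := OA _ OX.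
have inter j a h : Omega (a *: X) -> Omega (a *: y j) ->
    Vi (delta j (F (a *: y j) h)) = F (a *: X) (Vi (delta j h)).
  move=> O1 O2; have := nc_function_intertwining hF O2 O1 (bounded_inject hV j).
  have hr r : (fun h => Vi (delta j h)) \o (a *: y j) r =
      (a *: X) r \o (fun h => Vi (delta j h)).
    apply/funext => g; change (Vi (delta j (a *: y j r g)) = a *: X r (Vi (delta j g))).
    by rewrite (linZ (bounded_lin (bounded_inject hV j))) interX.
  by move=> /(_ hr)/(congr1 (fun f => f h)).
have OX1 : Omega (1 *: X) by rewrite scale1r.
have [e1 [M1 [e10 _ hnear]]] := omega_near hA hOmega hF OX1 AX.
pose rho := 1 + e1.
have rho1 : 1 < rho by rewrite /rho ltrDl.
have rho0 : 0 < rho by exact: lt_trans rho1.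
have rhoC : rho%:C != 0 :> R[i] by rewrite -normc_gt0 normcR gtr0_norm.
(* Openness at [X] reaches the real scalar [rho] > 1; balancedness then fills the disc. *)
have OaX a : cn a <= rho -> Omega (a *: X).
  move=> ha; have -> : a *: X = (a / rho%:C) *: (rho%:C *: X).
    by rewrite scalerA divfK.
  apply: scale_omega.
    by rewrite Normc.normcM Normc.normcV normcR gtr0_norm // ler_pdivrMr // mul1r.
  rewrite /rho rmorphD /=; apply: (proj1 (hnear _ _)).
  by rewrite normcR gtr0_norm.
have [M hM] : exists M : R, forall a, cn a <= rho -> opnorm (F (a *: X)) <= M.
  apply: locally_bounded_disc => a /OaX Oa.
  have [e [M [e0 M0 hM]]] := omega_near hA hOmega hF Oa AX.
  exists e, M; split=> // z /hM[_ hz]; exact: opnorm_le.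
have [K hK] := exhaustion_bounded hE k.
pose K1 := `|K| + 1; have K10 : 0 < K1 by rewrite ltr_wpDl.
have hy j r h : hnorm (y j r h) <= K1 * hnorm h.
  apply: le_trans (opnorm_bound (omega_bounded hA hOmega r (EO _ (Ey j))) h) _.
  rewrite ler_wpM2r ?hnorm_ge0 //; apply: le_trans (hK _ (Ey j) r) _.
  by apply: le_trans (ler_norm _) _; rewrite lerDl.
have [r [r0 r1 hr]] := nc_zero_cvg hA hU hOmega hF K10 O0
  (fun j => OA _ (EO _ (hx_ j))) (OA _ (EO _ hx)) (fun j => hy j.+1) (hy 0%N)
  (fun j b b1 => scale_omega b _ b1 (EO _ (hx_ j)))
  (fun b b1 => scale_omega b _ b1 (EO _ hx)) hcvg.
move=> h; apply/cvg_hnormP => e e0.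
(* Equals F(a y_j) h for |a| <= 1 and extends it to |a| <= rho, where a y_j itself may leave
   [Omega]. *)
pose f j a := V (F (a *: X) (Vi (delta j h))) j.
have fE j a : cn a <= 1 -> f j a = F (a *: y j) h.
  move=> a1; rewrite /f -inter ?(coord_inject hV) /delta ?eqxx //.
    by apply: OaX; exact: le_trans (ltW rho1).
  exact: scale_omega (EO _ (Ey j)).
have fx j a : cn a <= rho -> expandable (f j) a.
  move=> /OaX Oa; apply: (expandable_bounded_op (bounded_coord_oo hV j)).
  exact: (expandable_nc hA hU hOmega hF).
have [B fB] : exists B : R, forall j a, cn a <= rho -> hnorm (f j a) <= B.
  exists (M * hnorm h) => j a ha; rewrite /f.
  have coord_le g : hnorm (V g j) <= hnorm g.
    exact: coord_norm_le hV j g.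
  apply: le_trans (coord_le _) _; rewrite -[hnorm h](inject_norm hV j).
  apply: le_trans (opnorm_bound (nc_function_bounded_op hF (OaX _ ha)) _) _.
  by rewrite ler_wpM2r ?hnorm_ge0 ?hM.
(* Bernoulli gives rho^n >= 1 + n e1, so n > 2 B/(e e1) brings the outer bound below [e]. *)
have [n hn] : exists n : nat, 2 * B / rho ^+ n <= e.
  have B0 : 0 <= B.
    by apply: le_trans (hnorm_ge0 _) (fB 0%N 0 _); rewrite Normc.normc0 ltW.
  exists (Num.bound (2 * B / (e * e1))).
  have := archi_boundP (divr_ge0 (mulr_ge0 (ler0n R 2) B0) (ltW (mulr_gt0 e0 e10))).
  move: (Num.bound _) => n; rewrite ltr_pdivrMr ?mulr_gt0 // => hn.
  rewrite ler_pdivrMr ?exprn_gt0 //; have := bernoulli n (ltW e10) => hb.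
  apply: le_trans (ler_wpM2l (ltW e0) hb); apply: le_trans (ltW hn) _.
  by rewrite mulrDr mulr1 mulrCA lerDr ltW.
(* With [n] fixed, the inner circle must be controlled to e r^n, since [three_circles] divides by
   a^n. *)
have [N hN] := hr h (e * r ^+ n) (mulr_gt0 e0 (exprn_gt0 n r0)).
exists N => j Nj.
pose g a := f j.+1 a - f 0%N a.
have -> : F (x_ j) h - F x h = g 1.
  by rewrite /g !fE ?Normc.normc1 // !scale1r.
have := @three_circles _ _ g r rho (2 * B) e n r0 r1 (ltW rho1).
move=> H3; apply: le_trans (H3 _ _ _) _; last by rewrite ge_max lexx.
- by move=> a /andP[_ ar]; apply: expandable_sub; exact: fx.
- move=> a ar; rewrite /g !fE ?ar //; exact: hN.
- move=> a ar; rewrite /g; apply: le_trans (hnorm_triangleB _ _) _.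
  by rewrite mulr2n mulrDl mul1r; apply: lerD; apply: fB; rewrite ar.
Qed.
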